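(* For all $0<\alpha<1$ we have \[ V(\alpha)=\max\left\{\tfrac12,\alpha\right\}, \] where \[ V(\alpha)=\inf_{f\in C^{\alpha}[0,1]}\ \sup_{A\subset[0,1]}\left\{\dim_{\mathcal H}A:\ f|_{A}\text{ is of bounded variation}\right\}. \]
   Context: $C^{\alpha}[0,1]$ denotes the set of $\alpha$-Hölder continuous functions $f\colon[0,1]\to\mathbb R$, i.e. those for which there is a constant $c\in(0,\infty)$ with $|f(x)-f(y)|\le c|x-y|^{\alpha}$ for all $x,y\in[0,1]$. Sets $A\subset[0,1]$ are arbitrary non-empty sets. A function $g\colon A\to\mathbb R$ is of bounded variation if $\sup\{\sum_{i=1}^{n}|g(x_i)-g(x_{i-1})|: x_0<\dots<x_n,\ x_i\in A,\ n\ge1\}<\infty$. $\dim_{\mathcal H}$ denotes Hausdorff dimension. *)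

(* Defs.v *)
From HB Require Import structures.
From mathcomp Require Import all_boot all_order all_algebra.
From mathcomp Require Import all_classical all_reals all_analysis.
Import Order.TTheory GRing.Theory Num.Theory.
Import numFieldNormedType.Exports.

Set Implicit Arguments.
Unset Strict Implicit.
Unset Printing Implicit Defensive.

Local Open Scope classical_set_scope.
Local Open Scope ring_scope.

Section hausdorff.
Context {R : realType}.
Implicit Types (A U : set R) (s delta : R).

(* [diameter set0 = -oo], so the empty set is admissible in every cover. *)
Definition diameter U : \bar R :=
  ereal_sup [set `|p.1 - p.2|%:E | p in U `*` U].

(* The case split only matters for s = 0, where the conventions are that the
   empty set has weight 0 and a singleton has weight 0^0 = 1; hence the
   0-dimensional Hausdorff measure is the counting measure. *)
Definition hausdorff_weight s U : \bar R :=
  (if U == set0 then 0 else diameter U `^ s)%E.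

Definition hausdorff_premeasure s delta A : \bar R :=
  ereal_inf [set (\sum_(0 <= i <oo) hausdorff_weight s (U i))%E | U in
    [set U : (set R)^nat | A `<=` \bigcup_i U i /\
                           forall i, (diameter (U i) <= delta%:E)%E]].

(* The supremum over delta is the limit as delta decreases to 0. *)
Definition hausdorff_measure s A : \bar R :=
  ereal_sup [set hausdorff_premeasure s delta A | delta in [set d : R | 0 < d]].

Definition hausdorff_dim A : \bar R :=
  ereal_inf [set s%:E | s in
    [set s : R | 0 <= s /\ hausdorff_measure s A = 0%E]].

End hausdorff.

Section functions.
Context {R : realType}.
Implicit Types (A : set R) (f : R -> R).

(* Only the values of [f] on [0, 1] are constrained. *)
Definition hoelder01 (alpha : R) : set (R -> R) :=
  [set f | exists2 c : R, 0 < c &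
    forall x y : R, x \in `[0, 1] -> y \in `[0, 1] ->
      `|f x - f y| <= c * `|x - y| `^ alpha].

(* The library's [bounded_variation a b f] is the case [A = `[a, b]] with the
   endpoints fixed; here [a :: l] is the chain x_0 < ... < x_n of points of A,
   [b = x_n], and [l != [::]] is n >= 1. *)
Definition bounded_variation_on A f : Prop :=
  has_ubound [set v : R | exists a b l,
    [/\ itv_partition a b l, l != [::], {in a :: l, forall x, A x} &
        v = variation a b f l]].

Definition V (alpha : R) : \bar R :=
  ereal_inf [set ereal_sup [set hausdorff_dim A | A in
      [set A : set R | [/\ A !=set0, A `<=` `[0, 1] &
                           bounded_variation_on A f]]]
    | f in hoelder01 alpha].

End functions.

(* Main.v *)
Require Import Defs.
From mathcomp Require Import all_boot all_order all_algebra.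
From mathcomp Require Import all_classical all_reals all_analysis.
From mathcomp Require Import finmap ring lra zify.
Import Order.TTheory GRing.Theory Num.Theory.
Import numFieldNormedType.Exports.

Set Implicit Arguments.
Unset Strict Implicit.
Unset Printing Implicit Defensive.

Local Open Scope classical_set_scope.
Local Open Scope ring_scope.

(** Lower bound [alpha].  If [f] is alpha-Hoelder and [f 0 < f v], the points of
    [0, v] at which [f] takes a record value form a compact set on which [f] is
    nondecreasing, hence of bounded variation, and which [f] maps onto the
    interval [f 0, f v].  An alpha-Hoelder map multiplies dimension by at most
    1 / alpha, so the record set has dimension at least alpha
    ([exists_dim_ge_hoelder_exponent]).  Replacing [f] by [- f] covers every
    function that is not constant, and for a constant one the whole of [0, 1] will do.

    Lower bound 1/2.  Take an integer B.  Cut a finite chain E of points into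
    2 B consecutive blocks, drop every second block, and in each remaining block
    keep only the points whose values lie in the most popular of 2 B horizontal
    strips.  Each of the B blocks that remain keeps #|E| / (4 B^2) points, and the
    total height of the strips that were kept is only half the height of the
    original strip, so iterating costs a geometric series of variation. After
    m rounds a chain of (4 B^2)^m points has been thinned to B^m points, with
    variation bounded independently of m, and the dropped blocks ensure that
    an interval containing at most (4 B^2)^j of the original points contains
    at most B^j of the remaining ones ([thin_chain]). Applied to finer and
    finer grids, the thinned chains accumulate, along an ultrafilter, on a
    compact set; variation passes to this limit by continuity, and the
    counting bound excludes covers that are too cheap in dimension log B / log
    (4 B^2) ([exists_dim_ge_ratio]), which is as close to 1/2 as desired when
    B is large.

    Upper bound.  Let r = 3^a and q = 3^b with b < a.  The function
    [zigzag_limit r q] is self-affine: [0, 1] is cut into r q columns and the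
    range into r rows; the graph crosses row 0 back and forth q times, then
    row 1, and so on, and repeats this pattern inside each crossing.  It is
    Hoelder of exponent beta = log r / log (r q) = a / (a + b).  A set A meets at
    most q columns per row, and a chain of A that visits two rows at distance two
    or more inside one column pays a full row height of variation.  Hence the
    number M_k of depth-k columns met by a set of variation at most C satisfies
    M_(k+1) <= q (2 C r^(k+1) + 2 M_k).  As 3 q <= r, the second term cannot
    accumulate and M_k = O(r^k), so that A has dimension at most beta
    ([hausdorff_dim_zigzag_le]).  The ratios a / (a + b) with b < a are dense
    in (1/2, 1), and a function that is beta-Hoelder on [0, 1] is alpha-Hoelder
    for every smaller alpha; this is why the value is constant below 1/2. *)

(** * Variation along chains *)

Fixpoint chain_variation {R : realType} (f : R -> R) (a : R) (l : seq R) : R :=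
  if l is x :: l' then `|f x - f a| + chain_variation f x l' else 0.

Lemma chain_variationE (R : realType) (f : R -> R) (a b : R) (l : seq R) :
  variation a b f l = chain_variation f a l.
Proof.
elim: l a => [|x l IH] a; first exact: variation_nil.
rewrite /= -(IH x) /variation /= big_nat_recl//=.
Qed.

Lemma chain_variation_ge0 (R : realType) (f : R -> R) (a : R) (l : seq R) :
  0 <= chain_variation f a l.
Proof. by elim: l a => //= x l IH a; rewrite addr_ge0. Qed.

Lemma bounded_variation_on_intro (R : realType) (A : set R) (f : R -> R) (C : R) :
  (forall a l, path <%R a l -> {in a :: l, forall x, A x} ->
     chain_variation f a l <= C) ->
  bounded_variation_on A f.
Proof.
move=> H; exists C => v [a [b [l [[abl _] _ Al ->]]]].
by rewrite chain_variationE; apply: H.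
Qed.

Lemma bounded_variation_on_elim (R : realType) (A : set R) (f : R -> R) :
  bounded_variation_on A f ->
  exists2 C : R, 0 <= C & forall a l, path <%R a l ->
    {in a :: l, forall x, A x} -> chain_variation f a l <= C.
Proof.
move=> [C HC]; exists (Num.max C 0); first by rewrite le_max lexx orbT.
move=> a [|x l] al Al; first by rewrite le_max lexx orbT.
rewrite le_max -(chain_variationE _ _ (last a (x :: l))) HC//.
by exists a, (last a (x :: l)), (x :: l); split.
Qed.

(** * Hausdorff dimension of compact sets *)

(** Passing from the exponent [t] to the larger [s] only helps for lengths at
    most 1, which is why covers by sets of diameter at most 1 are used below. *)
Lemma poweR_lt_powR (R : realType) (s t v d : R) (D : \bar R) :
  0 <= t <= s -> 0 < s -> 0 <= d <= 1 -> (d%:E <= D)%E -> (D `^ t < v%:E)%E ->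
  d < v `^ s^-1.
Proof.
move=> /andP[t0 ts] s0 /andP[d0 d1] dD Dv.
have D0 : (0 <= D)%E by apply: le_trans dD; rewrite lee_fin.
have dtv : d `^ t < v.
  rewrite -lte_fin -poweR_EFin; apply: le_lt_trans Dv.
  by apply: gt0_ler_poweR => //; rewrite in_itv/= ?leey ?lee_fin ?d0 ?D0.
have v0 : 0 < v by rewrite (le_lt_trans _ dtv)// powR_ge0.
have [->|dn0] := eqVneq d 0; first exact: powR_gt0.
have dp : 0 < d by rewrite lt_neqAle eq_sym dn0.
have -> : d = (d `^ s) `^ s^-1 by rewrite -powRrM divff ?gt_eqF// powRr1.
apply: gt0_ltr_powR; rewrite ?invr_gt0// ?nnegrE ?powR_ge0 ?(ltW v0)//.
by apply: le_lt_trans dtv; apply: ger_powR => //; rewrite dp.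
Qed.

(** The cover that witnesses a null measure in some exponent [t < s] consists of
    arbitrary sets of diameter at most 1; enlarging them slightly to open balls
    keeps the sum small, and makes compactness available. *)
Lemma ball_cover_of_hausdorff_dim_lt (R : realType) (A : set R) (s e : R) :
  0 < s -> (hausdorff_dim A < s%:E)%E -> 0 < e ->
  exists x : R^nat, exists r : R^nat,
    [/\ forall i, 0 < r i, A `<=` \bigcup_i ball (x i) (r i) &
        forall n, \sum_(i < n) r i `^ s <= e].
Proof.
move=> s0 /ereal_inf_lt[_ [t [t0 HtA] <-]]; rewrite lte_fin => ts e0.
have : (hausdorff_premeasure t 1 A < (e / 2)%:E)%E.
  apply: (@le_lt_trans _ _ 0%E); last by rewrite lte_fin divr_gt0.
  by rewrite -HtA; apply: ereal_sup_ubound; exists 1 => //=.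
move=> /ereal_inf_lt[_ [U [AU Ud] <-]] HU.
have w0 i : (0 <= hausdorff_weight t (U i))%E.
  by rewrite /hausdorff_weight; case: ifP => // _; exact: poweR_ge0.
have psum n : (\sum_(i < n) hausdorff_weight t (U i) < (e / 2)%:E)%E.
  apply: le_lt_trans HU.
  by rewrite -(big_mkord xpredT (fun i => hausdorff_weight t (U i))); apply: nneseries_lim_ge.
have wfin i : hausdorff_weight t (U i) \is a fin_num.
  rewrite ge0_fin_numE//; apply: (@le_lt_trans _ _ (\sum_(j < i.+1) hausdorff_weight t (U j))%E).
    by rewrite big_ord_recr/= leeDr// sume_ge0.
  by rewrite (lt_trans (psum i.+1))// ltry.
pose w i := fine (hausdorff_weight t (U i)).
have w_ge0 i : 0 <= w i by apply: fine_ge0.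
(* A positive summand is added to the weight, because a set of weight zero
   still needs a ball of positive radius. *)
pose v i := w i + (e / 2) * 2^-1 ^+ i.+1.
have ev i : 0 < (e / 2) * 2^-1 ^+ i.+1 by rewrite mulr_gt0 ?divr_gt0// exprn_gt0 ?invr_gt0.
have v0 i : 0 < v i by rewrite ltr_wpDl.
pose x i := xget 0 (U i).
exists x, (fun i => v i `^ s^-1); split.
- by move=> i; exact: powR_gt0.
- move=> y /AU[i _ Uiy]; exists i => //.
  have Uix : U i (x i) by rewrite /x; case: xgetP => [z -> //|/(_ y)].
  have dD : (`|x i - y|%:E <= diameter (U i))%E.
    by apply: ereal_sup_ubound; exists (x i, y).
  rewrite -ball_normE/=; apply: (poweR_lt_powR _ s0 _ dD (t := t)).
  + by rewrite t0 ltW.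
  + by rewrite normr_ge0 -lee_fin (le_trans dD).
  + have : (hausdorff_weight t (U i) < (v i)%:E)%E.
      by rewrite -(fineK (wfin i)) lte_fin /v -/(w i) ltrDl.
    rewrite /hausdorff_weight; case: ifPn => // /eqP U0 _.
    by move: Uiy; rewrite U0.
- move=> n; under eq_bigr do rewrite -powRrM mulVf ?gt_eqF// powRr1 ?(ltW (v0 _))//.
  rewrite big_split/= [leRHS]splitr lerD//.
    apply: ltW; rewrite -lte_fin -sumEFin; apply: le_lt_trans (psum n).
    by apply: lee_sum => i _; rewrite /w fineK.
  rewrite -mulr_sumr ler_piMr ?divr_ge0 ?(ltW e0)//.
  have -> : \sum_(i < n) (2^-1 : R) ^+ i.+1 = 1 - 2^-1 ^+ n.
    elim: n {psum} => [|n IH]; first by rewrite big_ord0 expr0 subrr.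
    by rewrite big_ord_recr/= IH !exprS; lra.
  by rewrite gerBl exprn_ge0// invr_ge0.
Qed.

Lemma finite_ball_cover_of_hausdorff_dim_lt (R : realType) (A : set R) (s e : R) :
  compact A -> 0 < s -> (hausdorff_dim A < s%:E)%E -> 0 < e ->
  exists n, exists x : R^nat, exists r : R^nat,
    [/\ forall i, 0 < r i,
        forall y, A y -> exists2 i, (i < n)%N & `|x i - y| < r i &
        \sum_(i < n) r i `^ s <= e].
Proof.
move=> cA s0 dA e0; have [x [r [r0 Ar sr]]] := ball_cover_of_hausdorff_dim_lt s0 dA e0.
move: cA; rewrite compact_cover => /(_ nat setT (fun i => ball (x i) (r i)))[].
- by move=> i _; exact: ball_open.
- exact: Ar.
move=> D _ AD; exists (\max_(i <- D) i).+1, x, r; split => // y /AD[i /= iD].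
rewrite -ball_normE /= => yi; exists i => //.
by rewrite ltnS; exact: leq_bigmax_seq.
Qed.

(** * Sets of records *)

Lemma le_length_of_ball_cover (R : realType) (u v : R) (n : nat) (y r : R^nat) :
  u <= v -> (forall i, 0 <= r i) ->
  (forall z, u <= z <= v -> exists2 i, (i < n)%N & `|y i - z| <= r i) ->
  v - u <= \sum_(i < n) r i *+ 2.
Proof.
move=> uv r0 H; rewrite -lee_fin.
have -> : (v - u)%:E = lebesgue_measure (`[u, v]%classic : set R).
  rewrite lebesgue_measure_itv/= lte_fin.
  by move: uv; rewrite le_eqVlt => /predU1P[->|->]; rewrite ?ltxx ?subrr// EFinB.
pose F i : set R := `[y i - r i, y i + r i]%classic.
apply: (@le_trans _ _ (lebesgue_measure (\big[setU/set0]_(i < n) F i))).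
  apply: le_measure.
    by apply/mem_set; exact: measurable_itv.
    by apply/mem_set; apply: bigsetU_measurable => i _; exact: measurable_itv.
  move=> z /=; rewrite in_itv/= => /H[i ni]; rewrite ler_distl => zi.
  rewrite -bigcup_mkord; exists i => //; rewrite /F /= in_itv/=.
  by lra.
have vF i : lebesgue_measure (F i) = (r i *+ 2)%:E.
  rewrite lebesgue_measure_itv/= lte_fin; have := r0 i.
  case: ltP => ri r0i; rewrite -?EFinB; congr EFin; lra.
have mF i : (i < n)%N -> measurable (F i) by move=> _; exact: measurable_itv.
apply: le_trans (le_mu_bigsetU lebesgue_measure mF) _.
rewrite -sumEFin; apply: lee_sum => i _;  by rewrite -vF; exact: lexx.
Qed.

(** A cheap cover of [A] in exponent [s] would be mapped to a cover of [u, v]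
    of total length smaller than [v - u]. *)
Lemma hausdorff_dim_ge_of_hoelder_image (R : realType) (A : set R) (g : R -> R)
    (s c u v : R) :
  compact A -> 0 < s -> 0 < c -> u < v ->
  (forall x y, A x -> A y -> `|g x - g y| <= c * `|x - y| `^ s) ->
  (forall z, u <= z <= v -> exists2 x, A x & g x = z) ->
  (s%:E <= hausdorff_dim A)%E.
Proof.
move=> cA s0 c0 uv gA Ag; rewrite leNgt; apply/negP => dA.
have k0 : 0 < c * 2 `^ s by rewrite mulr_gt0// powR_gt0.
have e0 : 0 < (v - u) / (4 * (c * 2 `^ s)).
  by rewrite divr_gt0 ?subr_gt0// mulr_gt0.
have [n [x [r [r0 Ar sr]]]] := finite_ball_cover_of_hausdorff_dim_lt cA s0 dA e0.
(* Centres of balls need not lie in A, where alone g is controlled. *)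
pose a i := xget 0 (A `&` [set y | `|x i - y| < r i]).
have := @le_length_of_ball_cover R u v n (fun i => g (a i))
  (fun i => c * 2 `^ s * r i `^ s) (ltW uv).
have H1 : forall i : nat, 0 <= c * 2 `^ s * r i `^ s.
  by move=> i; rewrite mulr_ge0 ?powR_ge0// ltW.
move=> /(_ H1); have H2 : forall z, u <= z <= v -> exists2 i, (i < n)%N &
    `|g (a i) - z| <= c * 2 `^ s * r i `^ s.
  move=> z /Ag[y Ay <-]; have [i ni yi] := Ar y Ay; exists i => //.
  have [Aa ai] : (A `&` [set y | `|x i - y| < r i]) (a i).
    by rewrite /a; case: xgetP => [? -> //|/(_ y)]; case.
  apply: le_trans (gA _ _ Aa Ay) _.
  rewrite -mulrA ler_pM2l// -powRM ?(ltW (r0 i))//.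
  apply: ge0_ler_powR; rewrite ?nnegrE ?mulr_ge0 ?(ltW s0) ?(ltW (r0 i))//.
  have -> : a i - y = (x i - y) - (x i - a i) by lra.
  by apply: le_trans (ler_normB _ _) _; rewrite mulr_natl mulr2n ltW// ltrD.
move=> /(_ H2); rewrite sumrMnl -mulr_sumr => H.
have : c * 2 `^ s * (\sum_(i < n) r i `^ s) <= c * 2 `^ s * ((v - u) / (4 * (c * 2 `^ s))).
  by rewrite ler_pM2l.
have -> : c * 2 `^ s * ((v - u) / (4 * (c * 2 `^ s))) = (v - u) / 4.
  by field; rewrite gt_eqF ?powR_gt0// gt_eqF.
by rewrite mulr2n in H; lra.
Qed.

(** Clamping the argument to [0, 1] is 1-Lipschitz; it replaces [f] by a function
    that is Hoelder, hence continuous, on the whole line. *)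
Lemma hoelder01_extend (R : realType) (alpha : R) (f : R -> R) :
  0 < alpha -> hoelder01 alpha f ->
  exists g : R -> R, exists2 c : R, 0 < c &
    [/\ forall x y, `|g x - g y| <= c * `|x - y| `^ alpha,
        continuous g & {in `[0, 1], f =1 g}].
Proof.
move=> a0 [c c0 fc].
pose p (x : R) := Num.max 0 (Num.min x 1).
have p01 x : p x \in `[0, 1].
  by rewrite in_itv/= /p !(le_max, ge_max, le_min, ge_min) lexx ler01 lexx !orbT.
have pp x y : `|p x - p y| <= `|x - y|.
  have := ler_norm (x - y); have := ler_norm (y - x); rewrite (distrC y x).
  rewrite ler_norml; move: `|x - y| => N yx xy; rewrite /p.
  have [?|?] := leP x 1; have [?|?] := leP y 1.
  - by have [?|?] := leP 0 x; have [?|?] := leP 0 y; lra.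
  - by rewrite (max_r (@ler01 R)); have [?|?] := leP 0 x; lra.
  - by rewrite (max_r (@ler01 R)); have [?|?] := leP 0 y; lra.
  - lra.
have gh x y : `|f (p x) - f (p y)| <= c * `|x - y| `^ alpha.
  apply: le_trans (fc _ _ (p01 x) (p01 y)) _; rewrite ler_pM2l//.
  by apply: ge0_ler_powR; rewrite ?nnegrE ?(ltW a0)//.
exists (f \o p), c => //; split => //.
- move=> x; apply/cvgrPdist_lt  => e e0; near=> y.
  apply: le_lt_trans (gh x y) _.
  rewrite mulrC -ltr_pdivlMr//.
  have -> : e / c = ((e / c) `^ alpha^-1) `^ alpha.
    by rewrite -powRrM mulVf ?gt_eqF// powRr1// ltW// divr_gt0.
  apply: gt0_ltr_powR; rewrite ?nnegrE ?powR_ge0//.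
  near: y; apply: cvgr_dist_lt => //; exact/powR_gt0/divr_gt0.
- move=> x; rewrite in_itv/= => /andP[x0 x1] /=.
  by rewrite /p min_l// max_r.
Unshelve. all: by end_near. Qed.

Lemma chain_variationN (R : realType) (f : R -> R) (a : R) (l : seq R) :
  chain_variation (\- f) a l = chain_variation f a l.
Proof. by elim: l a => //= x l IH a; rewrite IH -opprD normrN. Qed.

Lemma eq_chain_variation (R : realType) (f g : R -> R) (a : R) (l : seq R) :
  {in a :: l, f =1 g} -> chain_variation f a l = chain_variation g a l.
Proof.
elim: l a => //= x l IH a fg; rewrite IH.
  by rewrite !fg// !inE eqxx ?orbT.
by move=> y yl; rewrite fg// inE yl orbT.
Qed.

Lemma first_hitting_time (R : realType) (g : R -> R) (v z : R) :
  continuous g -> 0 <= v -> g 0 <= z <= g v ->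
  exists2 x, 0 <= x <= v & g x = z /\ forall y, 0 <= y -> y < x -> g y < z.
Proof.
move=> cg v0 /andP[z0 zv].
pose S := [set x | 0 <= x <= v /\ z <= g x].
have Sv : S v by split => //; rewrite v0 lexx.
have lS : lbound S 0 by move=> x [/andP[]].
have hS : has_inf S by split; [exists v|exists 0].
have i0 : 0 <= inf S by apply: lb_le_inf => //; exists v.
have iv : inf S <= v by apply: ge_inf => //; exists 0.
have before y : 0 <= y -> y < inf S -> g y < z.
  move=> y0 yi; rewrite ltNge; apply/negP => zy.
  have : inf S <= y by apply: ge_inf; [exists 0|split => //; rewrite y0 (le_trans (ltW yi))].
  by rewrite leNgt yi.
have zi : z <= g (inf S).
  rewrite leNgt; apply/negP => gz.
  have : \forall x \near inf S, g x < z by exact: (cvgr_lt (g (inf S)) (cg (inf S)) z gz).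
  move=> /nbhs_ballP[e /= e0 He].
  have [x Sx xe] := inf_adherent e0 hS.
  have xi : inf S <= x by apply: ge_inf => //; exists 0.
  have /= := He x; rewrite -ball_normE/= ltr_norml => /(_ _).
  have [_ zx] := Sx; move=> H; suff : g x < z by rewrite ltNge zx.
  by apply: H; lra.
have [] := @IVT R g 0 (inf S) z i0.
- by apply: continuous_subspaceT => x; exact: cg.
- by rewrite min_l ?max_r ?z0// (le_trans z0 zi).
move=> x; rewrite in_itv/= => /andP[x0 xi] gx.
have ex : x = inf S.
  apply/eqP; rewrite eq_le xi/=; apply: ge_inf; first by exists 0.
  by split; rewrite ?gx// x0 (le_trans xi).
by exists x; rewrite ?x0 ex ?iv// -?ex; split => // y y0; rewrite ex; exact: before.
Qed.

(** The set of records of [g] on [0, v]: by [first_hitting_time] it is mapped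
    onto [g 0, g v]. *)
Lemma record_set_dim (R : realType) (alpha c v : R) (g : R -> R) :
  0 < alpha -> 0 < c -> 0 < v <= 1 ->
  (forall x y, `|g x - g y| <= c * `|x - y| `^ alpha) -> continuous g ->
  g 0 < g v ->
  exists A : set R, [/\ A !=set0, A `<=` `[0, 1], bounded_variation_on A g &
    (alpha%:E <= hausdorff_dim A)%E].
Proof.
move=> a0 c0 /andP[v0 v1] gh cg g0v.
pose A : set R := `[0, v]%classic `&`
  \bigcap_(y in [set y : R | 0 <= y]) ([set x | x <= y] `|` [set x | g y <= g x]).
have A01 x : A x -> 0 <= x <= 1.
  by move=> [/=]; rewrite in_itv/= => /andP[-> xv] _ /=; exact: le_trans v1.
have Arec x y : A x -> A y -> x < y -> g x <= g y.
  move=> Ax [_ /(_ x)]; have /andP[x0 _] := A01 x Ax.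
  by move=> /(_ x0)[/= yx xy|//]; lra.
have A_hit z : g 0 <= z <= g v -> exists2 x, A x & g x = z.
  move=> zv; have [x /andP[x0 xv] [gx Hx]] := first_hitting_time cg (ltW v0) zv.
  exists x => //; split; first by rewrite /= in_itv/= x0 xv.
  move=> y /= y0; have [xy|yx] := leP x y; first by left.
  by right; rewrite /= gx ltW// Hx.
exists A; split.
- by have [|x Ax _] := A_hit (g 0); [rewrite lexx ltW|exists x].
- by move=> x /A01; rewrite /= in_itv.
- apply: (@bounded_variation_on_intro _ _ _ (g 0 + c - g 0)) => a l al Al.
  have bnd x : A x -> g x <= g 0 + c.
    move=> /A01 /andP[x0 x1]; rewrite -lerBlDl; apply: le_trans (ler_norm _) _.
    apply: le_trans (gh _ _) _; rewrite ler_piMr ?(ltW c0)// subr0 ger0_norm//.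
    have [->|xn] := eqVneq x 0; first by rewrite powR0// gt_eqF.
    apply: (@le_trans _ _ (1 `^ alpha)); last by rewrite powR1.
    by apply: ge0_ler_powR; rewrite ?nnegrE ?(ltW a0).
  have g0 x : A x -> g 0 <= g x.
    move=> [/=]; rewrite in_itv/= => /andP[x0 _] /(_ 0 (lexx 0))[/= x0'|//].
    by have -> : x = 0 by lra.
  apply: (@le_trans _ _ (g 0 + c - g a)); last first.
    by rewrite lerD2l lerN2; apply/g0/Al; rewrite inE eqxx.
  elim: l a al Al => [|x l IH] a /=; first by move=> _ Al; rewrite subr_ge0; apply/bnd/Al; rewrite inE.
  move=> /andP[ax xl] Al.
  have Aa : A a by apply: Al; rewrite inE eqxx.
  have Ax : A x by apply: Al; rewrite !inE eqxx orbT.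
  have := IH x xl; have gax := Arec _ _ Aa Ax ax.
  rewrite ger0_norm ?subr_ge0// => H.
  suff : chain_variation g x l <= g 0 + c - g x by lra.
  by apply: H => y yl; apply: Al; rewrite inE yl orbT.
- apply: (@hausdorff_dim_ge_of_hoelder_image _ A g alpha c (g 0) (g v)) => //.
  apply: (@subclosed_compact _ _ `[0, v]); last by move=> x [].
    apply: closedI; first exact: itv_closed.
    apply: closed_bigI => y _; apply: closedU; first exact: closed_le.
    by apply: (@closed_comp _ _ g [set z | g y <= z]); [move=> x _; exact: cg|exact: closed_ge].
  exact: segment_compact.
Qed.

Lemma exists_dim_ge_hoelder_exponent (R : realType) (alpha : R) (f : R -> R) :
  0 < alpha < 1 -> hoelder01 alpha f ->
  exists A : set R, [/\ A !=set0, A `<=` `[0, 1], bounded_variation_on A f &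
    (alpha%:E <= hausdorff_dim A)%E].
Proof.
move=> /andP[a0 a1] /(hoelder01_extend a0)[g [c c0 [gh cg fg]]].
suff [A [A0 A01 bA dA]] : exists A : set R,
    [/\ A !=set0, A `<=` `[0, 1], bounded_variation_on A g &
    (alpha%:E <= hausdorff_dim A)%E].
  exists A; split => //; have [C _ HC] := bounded_variation_on_elim bA.
  apply: (@bounded_variation_on_intro _ _ _ C) => a l al Al.
  by rewrite (@eq_chain_variation _ f g) ?HC// => x /Al/A01; exact: fg.
have [[v v01 gv]|H] := pselect (exists2 v, 0 < v <= 1 & g v != g 0).
  move: gv; rewrite neq_lt => /orP[gv|gv]; last exact: record_set_dim gh cg gv.
  have ngh x y : `|(\- g) x - (\- g) y| <= c * `|x - y| `^ alpha.
    by rewrite /= -opprD normrN.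
  have ncg : continuous (\- g) by move=> x; apply: cvgN; exact: cg.
  have ngv : (\- g) 0 < (\- g) v by rewrite /= ltrN2.
  have [A [A0 A01 bA dA]] := record_set_dim a0 c0 v01 ngh ncg ngv.
  exists A; split => //; have [C _ HC] := bounded_variation_on_elim bA.
  apply: (@bounded_variation_on_intro _ _ _ C) => a l al Al.
  by rewrite -chain_variationN HC.
have g0 x : 0 <= x <= 1 -> g x = g 0.
  move=> /andP[x0 x1]; have [->//|xn] := eqVneq x 0.
  by apply/eqP/negPn/negP => gx; apply: H; exists x => //; rewrite lt_neqAle eq_sym xn x0.
exists `[0, 1]%classic; split => //.
- by exists 0; rewrite /= in_itv/= lexx ler01.
- apply: (@bounded_variation_on_intro _ _ _ 0) => a l _.
  elim: l a => //= x l IH a Al.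
  have a01 : 0 <= a <= 1 by have := Al a (mem_head _ _); rewrite /= in_itv.
  have x01 : 0 <= x <= 1.
    by have := Al x; rewrite !inE eqxx orbT => /(_ isT); rewrite /= in_itv.
  by rewrite !g0// subrr normr0 add0r IH// => y yl; apply: Al; rewrite inE yl orbT.
- apply: (@hausdorff_dim_ge_of_hoelder_image _ _ id alpha 1 0 1) => //.
  + exact: segment_compact.
  + move=> x y /=; rewrite !in_itv/= mul1r => /andP[x0 x1] /andP[y0 y1].
    have [->|xn] := eqVneq `|x - y| 0; first exact: powR_ge0.
    apply: ger1_powR; last exact: ltW.
    by rewrite lt_neqAle eq_sym xn normr_ge0/= ler_norml; lra.
  + by move=> z z01; exists z.
Qed.

(** * Finite chains of small variation *)

Definition convex_pred {R : realType} (P : pred R) : Prop :=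
  forall x y z, x < y -> y < z -> P x -> P z -> P y.

Definition chains_bounded {R : realType} (f : R -> R) (A : seq R) (C : R) : Prop :=
  forall a l, path <%R a l -> {subset a :: l <= A} -> chain_variation f a l <= C.

Lemma chain_variation_cat (R : realType) (f : R -> R) (a : R) (l1 l2 : seq R) :
  chain_variation f a (l1 ++ l2) =
  chain_variation f a l1 + chain_variation f (last a l1) l2.
Proof. by elim: l1 a => [|x l IH] a /=; rewrite ?add0r// IH addrA. Qed.

Lemma chain_split (R : realType) (A1 A2 : seq R) (a : R) (l : seq R) :
  (forall x y, x \in A1 -> y \in A2 -> x < y) ->
  path <%R a l -> a \in A1 -> {subset l <= A1 ++ A2} ->
  exists l1 l2, [/\ l = l1 ++ l2, {subset l1 <= A1} & {subset l2 <= A2}].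
Proof.
move=> A12; elim: l a => [|x l IH] a /=; first by exists [::], [::].
move=> /andP[ax xl] aA lA.
have [xA1|xA1] := boolP (x \in A1).
  have [y yl|l1 [l2 [-> l1A l2A]]] := IH x xl xA1.
    by apply: lA; rewrite inE yl orbT.
  exists (x :: l1), l2; split => // y; rewrite inE => /predU1P[->//|]; exact: l1A.
exists [::], (x :: l); split => // y yl.
have xA2 : x \in A2 by have := lA x; rewrite inE eqxx mem_cat (negPf xA1) => /(_ isT).
have := lA y yl; rewrite mem_cat => /orP[yA1|//].
have yx := A12 _ _ yA1 xA2.
move: yl; rewrite inE => /predU1P[yx'|yl]; first by rewrite yx' ltxx in yx.
by have /allP/(_ _ yl) := order_path_min lt_trans xl; rewrite ltNge ltW.
Qed.

Lemma chains_bounded_cat (R : realType) (f : R -> R) (A1 A2 : seq R) (C1 C2 w : R) :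
  (forall x y, x \in A1 -> y \in A2 -> x < y) ->
  (forall x y, x \in A1 -> y \in A2 -> `|f y - f x| <= w) ->
  0 <= w -> 0 <= C1 -> 0 <= C2 ->
  chains_bounded f A1 C1 -> chains_bounded f A2 C2 ->
  chains_bounded f (A1 ++ A2) (C1 + w + C2).
Proof.
move=> A12 fw w0 C10 C20 H1 H2 a l al aA.
have lA : {subset l <= A1 ++ A2} by move=> y yl; apply: aA; rewrite inE yl orbT.
have [aA1|aA1] := boolP (a \in A1); last first.
  have aA2 : a \in A2 by have := aA a; rewrite inE eqxx mem_cat (negPf aA1) => /(_ isT).
  apply: (@le_trans _ _ C2); last by rewrite lerDr addr_ge0.
  apply: H2 => // y; rewrite inE => /predU1P[->//|yl].
  have := lA y yl; rewrite mem_cat => /orP[yA1|//].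
  have /allP/(_ _ yl) := order_path_min lt_trans al.
  by rewrite ltNge ltW// A12.
have [l1 [l2 [el l1A l2A]]] := chain_split A12 al aA1 lA.
move: al; rewrite el cat_path => /andP[al1 al2].
have lastA : last a l1 \in A1.
  by have := mem_last a l1; rewrite inE => /predU1P[->//|]; exact: l1A.
rewrite chain_variation_cat -addrA lerD//.
  by apply: H1 => // y; rewrite inE => /predU1P[->//|]; exact: l1A.
case: l2 l2A al2 {el} => [|y l2] l2A /=; first by rewrite addr_ge0.
move=> /andP[_ yl2]; rewrite lerD// ?fw// ?l2A ?inE ?eqxx//.
exact: H2.
Qed.

Lemma pigeonhole_values (R : realType) (f : R -> R) (k n : nat) (u d : R) (E : seq R) :
  (k.+1 * n <= size E)%N -> {in E, forall x, u <= f x <= u + d *+ k.+1} ->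
  exists v E', [/\ subseq E' E, size E' = n & {in E', forall x, v <= f x <= v + d}].
Proof.
elim: k u E => [|k IH] u E sE fE.
  exists u, (take n E); split; first exact: take_subseq.
    by rewrite size_takel// -(mul1n n).
  by move=> x /mem_take/fE; rewrite mulr1n.
pose E1 := [seq x <- E | f x <= u + d].
have [nE1|nE1] := leqP n (size E1).
  exists u, (take n E1); split.
  - exact: subseq_trans (take_subseq _ _) (filter_subseq _ _).
  - exact: size_takel.
  - by move=> x /mem_take; rewrite mem_filter => /andP[-> /fE/andP[->]].
pose E2 := [seq x <- E | ~~ (f x <= u + d)].
have [|x|v [E' [sE' nE' fE']]] := IH (u + d) E2.
- have : (size E1 + size E2 = size E)%N.
    by rewrite !size_filter; exact: (count_predC (fun x => f x <= u + d)).
  by move: sE nE1; rewrite [(k.+2 * n)%N]mulSn; lia.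
- rewrite mem_filter -ltNge => /andP[/ltW -> /fE/andP[_]].
  by rewrite -addrA -mulrS.
- exists v, E'; split => //; exact: subseq_trans sE' (filter_subseq _ _).
Qed.

(** The last clause is a discrete Frostman condition of exponent
    log B / log (4 B^2), phrased with cardinals so that it does not depend on the
    spacing of [E]. *)
Definition thinning {R : realType} (f : R -> R) (B m : nat) (E A : seq R)
    (N : nat) (C : R) : Prop :=
  [/\ subseq A E, size A = N, chains_bounded f A C &
      forall (P : pred R) (j : nat), convex_pred P -> (j <= m)%N ->
        (count P E <= (4 * B ^ 2) ^ j)%N -> (count P A <= B ^ j)%N].

Section thin_chain.
Context {R : realType} (f : R -> R) (B : nat) (B0 : (0 < B)%N).
Let L := (4 * B ^ 2)%N.


(** A chain of length [b] times a double block: [b] thinned blocks are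
    concatenated, and each costs [w] inside and at most [w] for the jump to the
    next one, since its 2 B strips have height [w / (2 B)]. *)
Let thin_blocks (m b : nat) (u w : R) (E : seq R) :
  (forall (E : seq R) (u w : R), 0 <= w -> sorted <%R E -> size E = (L ^ m)%N ->
     {in E, forall x, u <= f x <= u + w} ->
     exists A, thinning f B m E A (B ^ m) (w *+ (2 * B))) ->
  0 <= w -> sorted <%R E -> (b * (4 * B * L ^ m) <= size E)%N ->
  {in E, forall x, u <= f x <= u + w} ->
  exists A, thinning f B m E A (b * B ^ m) (w *+ (2 * b)).
Proof.
move=> IHm w0; elim: b E => [|b IH] E sE nE fE.
  exists [::]; split => //; first exact: sub0seq.
  by move=> a l _ /(_ a); rewrite inE eqxx => /(_ isT).
have L0 : (0 < L ^ m)%N by rewrite expn_gt0 /L muln_gt0 expn_gt0 B0.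
pose h := (2 * B * L ^ m)%N.
have hL : (L ^ m <= h)%N by rewrite /h leq_pmull// muln_gt0.
have nEh : (b * (2 * h) + 2 * h <= size E)%N.
  by move: nE; rewrite mulSn /h; move: (L ^ m)%N => ? ; lia.
pose E1 := take h E; pose G := take h (drop h E); pose E2 := drop h (drop h E).
have eE : E = E1 ++ (G ++ E2) by rewrite !cat_take_drop.
have sE1 : size E1 = h by rewrite size_takel//; lia.
have sG : size G = h by rewrite size_takel// size_drop; lia.
have sE2 : (b * (4 * B * L ^ m) <= size E2)%N.
  by rewrite !size_drop; move: nEh; rewrite /h; move: (L ^ m)%N => ?; lia.
have [] : [/\ sorted <%R E1, sorted <%R E2, forall x y, x \in E1 -> y \in G -> x < y &
   forall y z, y \in G -> z \in E2 -> y < z].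
  move: sE; rewrite {1}eE !(sorted_pairwise lt_trans) !pairwise_cat.
  move=> /and3P[/allrelP E1GE2 -> /and3P[/allrelP GE2 _ ->]].
  split => //.
  move=> x y xE yG.
  by apply: E1GE2; rewrite ?mem_cat ?yG.
move=> srt1 srt2 E1G GE2.
have G0 : {y | y \in G}.
  by exists (nth 0 G 0); apply: mem_nth; rewrite sG (leq_trans L0).
have sub1 : {subset E1 <= E} by move=> x; rewrite eE mem_cat => ->.
have sub2 : {subset E2 <= E} by move=> x; rewrite eE !mem_cat => ->; rewrite !orbT.
(* E1 has 2 B L^m points, enough for one of 2 B strips to contain L^m of them. *)
have [v [E' [sE' nE' fE']]] : exists v E', [/\ subseq E' E1, size E' = (L ^ m)%N &
    {in E', forall x, v <= f x <= v + w / (2 * B)%:R}].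
  apply: (@pigeonhole_values R f (2 * B).-1 _ u); rewrite prednK ?muln_gt0// ?sE1//.
  by move=> x /sub1/fE; rewrite -[w / _ *+ _]mulr_natr divfK// pnatr_eq0 -lt0n muln_gt0.
have [||||A1 [A1E' nA1 cA1 PA1]] := IHm E' v (w / (2 * B)%:R) => //.
- by rewrite divr_ge0.
- by apply: (subseq_sorted lt_trans sE').
have A1E : subseq A1 E1 := subseq_trans A1E' sE'.
have [||A2 [A2E nA2 cA2 PA2]] := IH E2 srt2 => //.
  by move=> x /sub2/fE.
exists (A1 ++ A2); split.
- rewrite eE; apply: cat_subseq => //.
  exact: subseq_trans A2E (suffix_subseq _ _).
- by rewrite size_cat nA1 nA2 mulSn.
- have -> : w *+ (2 * b.+1) = w / (2 * B)%:R *+ (2 * B) + w + w *+ (2 * b).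
    rewrite -[X in X + w]mulr_natr divfK ?pnatr_eq0 -?lt0n ?muln_gt0//.
    by rewrite mulnS mulrnDr mulr2n.
  apply: chains_bounded_cat => //.
  + move=> x y /(mem_subseq A1E) x1 /(mem_subseq A2E) y2.
    have [z zG] := G0; exact: lt_trans (E1G _ _ x1 zG) (GE2 _ _ zG y2).
  + move=> x y /(mem_subseq A1E)/sub1/fE/andP[x1 x2] /(mem_subseq A2E)/sub2/fE/andP[y1 y2].
    by rewrite ler_norml; lra.
  + by rewrite mulrn_wge0// divr_ge0.
  + by rewrite mulrn_wge0.
- move=> P j cP jm PE.
  have LjLm : (L ^ j <= L ^ m)%N by rewrite leq_pexp2l// muln_gt0 expn_gt0 B0.
  have cE : (count P E = count P E1 + (count P G + count P E2))%N.
    by rewrite {1}eE !count_cat.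
  rewrite count_cat.
  (* A convex set meeting both parts would contain the gap between them. *)
  have : ~~ has P A1 || ~~ has P A2.
    rewrite -negb_and; apply/negP => /andP[/hasP[x xA Px] /hasP[z zA Pz]].
    have xE := mem_subseq A1E xA; have zE := mem_subseq A2E zA.
    have : all P G.
      by apply/allP => y yG; apply: (cP x y z) => //; [exact: E1G|exact: GE2].
    rewrite all_count sG => /eqP PG.
    have : (0 < count P E1)%N by rewrite -has_count; apply/hasP; exists x.
    have := leq_trans PE (leq_trans LjLm hL).
    by rewrite cE PG; clear; lia.
  rewrite !has_count -!leqNgt !leqn0 => /orP[] /eqP ->.
    by rewrite add0n; apply: PA2 => //; apply: leq_trans PE; rewrite cE addnA leq_addl.
  rewrite addn0; apply: PA1 => //.
  by apply: leq_trans (leq_count_subseq P sE') (leq_trans _ PE); rewrite cE leq_addr.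
Qed.

Lemma thin_chain (m : nat) (E : seq R) (u w : R) :
  0 <= w -> sorted <%R E -> size E = (L ^ m)%N ->
  {in E, forall x, u <= f x <= u + w} ->
  exists A, thinning f B m E A (B ^ m) (w *+ (2 * B)).
Proof.
elim: m E u w => [|m IH] E u w w0 sE nE fE.
  exists E; split => //.
  - case: E nE {sE fE} => [//|x [|//]] _ a [|y l] /=; first by rewrite mulrn_wge0.
    move=> /andP[ay _] H; have := H a; have := H y; rewrite !inE !eqxx ?orbT.
    by move=> /(_ isT)/eqP ey /(_ isT)/eqP ea; rewrite ey ea ltxx in ay.
  - by move=> P j _; rewrite leqn0 => /eqP ->; rewrite !expn0.
have [|A [AE nA cA PA]] := @thin_blocks m B u w E IH w0 sE _ fE.
  rewrite nE expnS; move: (L ^ m)%N => X.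
  by rewrite /L -mulnn !mulnA (mulnC B 4).
exists A; split => //; first by rewrite nA expnS.
move=> P j cP; rewrite leq_eqVlt => /predU1P[-> _|]; last exact: PA.
by rewrite (leq_trans (count_size _ _))// nA expnS.
Qed.

End thin_chain.

(** * Limits of finite chains along an ultrafilter *)

Lemma exists_scale (R : realType) (q d : R) : 1 < q -> 0 < d <= 1 ->
  exists e : nat, (q ^+ e.+1)^-1 < d <= (q ^+ e)^-1.
Proof.
move=> q1 /andP[d0 d1].
have q0 : 0 < q by rewrite (lt_trans _ q1).
have ex : exists n, (q ^+ n.+1)^-1 < d.
  have [n dn] : exists n : nat, d^-1 < q ^+ n.+1.
    exists (Num.truncn (d^-1 / (q - 1))).+1.
    have := truncnS_gt (d^-1 / (q - 1)).
    move: (Num.truncn _) => n; rewrite ltr_pdivrMr ?subr_gt0// => H.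
    apply: lt_le_trans H _.
    have bern k : k%:R * (q - 1) <= q ^+ k.
      elim: k => [|k IH]; first by rewrite mul0r expr0.
      rewrite exprS -natr1 mulrDl mul1r.
      have qk : 1 <= q ^+ k by rewrite exprn_ege1// ltW.
      have -> : q * q ^+ k = q ^+ k + (q - 1) * q ^+ k by ring.
      by rewrite lerD// ler_peMr// subr_ge0 ltW.
    by apply: le_trans (bern _) _; rewrite ler_weXn2l// ltW.
  by exists n; rewrite invf_plt ?posrE ?exprn_gt0.
have := ex_minnP ex; case=> n Hn Hmin; exists n; rewrite Hn/=.
case: n Hn Hmin => [|n] Hn Hmin; first by rewrite expr0 invr1.
by rewrite leNgt; apply/negP => /Hmin; rewrite ltnn.
Qed.

(** With an ultrafilter in place of a subsequence, every chain of limit points is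
    approximated inside one and the same [A m]. *)
Definition limit_set {R : realType} (U : set_system nat) (A : nat -> seq R) : set R :=
  [set x | forall e, 0 < e -> U [set m | exists2 y, y \in A m & `|x - y| < e]].

Lemma limit_set_itv (R : realType) (U : set_system nat) (UU : UltraFilter U)
    (A : nat -> seq R) :
  (forall m y, y \in A m -> 0 <= y <= 1) -> limit_set U A `<=` `[0, 1].
Proof.
move=> A01 x Ax; rewrite /= in_itv/=; apply/negPn/negP; rewrite negb_and -!ltNge => H.
have [e e0 He] : exists2 e, 0 < e & forall y, 0 <= y <= 1 -> e <= `|x - y|.
  case/orP: H => H; [exists (- x)|exists (x - 1)]; rewrite ?oppr_gt0 ?subr_gt0//.
    by move=> y /andP[y0 y1]; rewrite distrC; apply: le_trans (ler_norm _); lra.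
  by move=> y /andP[y0 y1]; apply: le_trans (ler_norm _); lra.
have [m [y /A01/He]] := @filter_ex _ _ _ _ (Ax e e0).
by rewrite leNgt => /negP.
Qed.

Lemma limit_set_compact (R : realType) (U : set_system nat) (UU : UltraFilter U)
    (A : nat -> seq R) :
  (forall m y, y \in A m -> 0 <= y <= 1) -> compact (limit_set U A).
Proof.
move=> A01; apply: (subclosed_compact _ (@segment_compact _ 0 1)); last exact: limit_set_itv.
move=> x clx e e0.
have e2 : 0 < e / 2 by rewrite divr_gt0.
have [y [Ay]] := clx (ball x (e / 2)) (nbhsx_ballx _ _ e2).
rewrite -ball_normE/= => xy.
apply: filterS (Ay (e / 2) e2).
move=> m [z zA yz]; exists z => //.
by have := ler_distD y x z; lra.
Qed.

(** Otherwise points of [A m] outside [V] could be chosen for [U]-many [m]; they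
    would accumulate at a point of the limit set outside [V]. *)
Lemma limit_set_open_cover (R : realType) (U : set_system nat) (UU : UltraFilter U)
    (A : nat -> seq R) (V : set R) :
  (forall m y, y \in A m -> 0 <= y <= 1) ->
  open V -> limit_set U A `<=` V -> U [set m | forall y, y \in A m -> V y].
Proof.
move=> A01 oV AV; set W := (X in U X).
have [//|UnW] := in_ultra_setVsetC W UU.
pose y m := xget 0 [set z | z \in A m /\ ~ V z].
have yP m : (~` W) m -> y m \in A m /\ ~ V (y m).
  move=> Wm; rewrite /y; case: xgetP => [z -> //|none].
  exfalso; apply: Wm => z zA; apply: contrapT => nV.
  exact: (none z).
have y01 : (y @ U) `[0, 1]%classic.
  suff : U (y @^-1` `[0, 1]%classic) by [].
  by apply: filterS UnW => m /yP[/A01 ? _]; rewrite /= in_itv.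
have [x [_ clx]] := @segment_compact R 0 1 (y @ U) _ y01.
have Ux N : nbhs x N -> U (y @^-1` N).
  move=> xN; have [//|UN] := in_ultra_setVsetC (y @^-1` N) UU.
  have [z [/= ? ?]] := clx (~` N) N UN xN; by [].
have Ax : limit_set U A x.
  move=> e e0; apply: filterS (filterI UnW (Ux _ (nbhsx_ballx x e e0))).
  by move=> m [/yP[yA _]] /=; rewrite -ball_normE/=; exists (y m).
have [m [/yP[_ nV]]] := @filter_ex _ _ _ _ (filterI UnW (Ux V (open_nbhs_nbhs (conj oV (AV _ Ax))))).
by [].
Qed.

Lemma limit_set_chain (R : realType) (U : set_system nat) (UU : UltraFilter U)
    (A : nat -> seq R) (f : R -> R) (a : R) (l : seq R) (e : R) :
  continuous f -> path <%R a l -> {in a :: l, forall x, limit_set U A x} -> 0 < e ->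
  U [set m | exists a' l', [/\ path <%R a' l', {subset a' :: l' <= A m},
    `|a - a'| < e, `|f a - f a'| < e &
    chain_variation f a l <= chain_variation f a' l' + e]].
Proof.
move=> cf.
have near_point x d : limit_set U A x -> 0 < d ->
    U [set m | exists y, [/\ y \in A m, `|x - y| < d & `|f x - f y| < d]].
  move=> Ax d0; have /cvgrPdist_lt /(_ d d0) /nbhs_ballP[r /= r0 Hr] := cf x.
  apply: filterS (Ax (Num.min d r) _); last by rewrite lt_min d0.
  move=> m [y yA]; rewrite lt_min => /andP[xd xr]; exists y; split => //.
  by apply: Hr; rewrite -ball_normE.
elim: l a e => [|x l IH] a e al aA e0.
  apply: filterS (near_point a e _ e0); last by apply: aA; rewrite inE.
  move=> m [y [yA ? ?]]; exists y, [::]; split => //=; last by rewrite add0r ltW.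
  by move=> z; rewrite inE => /eqP ->.
move: al => /= /andP[ax xl].
pose d := Num.min (e / 4) ((x - a) / 2).
have d0 : 0 < d by rewrite lt_min !divr_gt0// subr_gt0.
have Aa : limit_set U A a by apply: aA; rewrite inE eqxx.
have xlA : {in x :: l, forall y, limit_set U A y}.
  by move=> y yl; apply: aA; rewrite inE yl orbT.
have IHx := IH x d xl xlA d0.
apply: filterS (filterI (near_point a d Aa d0) IHx).
move=> m [[a' [a'A aa' faa']] [x' [l' [xl' x'A xx' fxx' Hl]]]].
have de : d <= e / 4 by rewrite ge_min lexx.
have dx : d <= (x - a) / 2 by rewrite ge_min lexx orbT.
exists a', (x' :: l'); split => //=.
- rewrite xl' andbT; move: aa' xx'; rewrite !ltr_distl => /andP[? ?] /andP[? ?]; lra.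
- by move=> y; rewrite inE => /predU1P[->|/x'A].
- lra.
- lra.
- have : `|f x - f a| <= `|f x - f x'| + `|f x' - f a'| + `|f a - f a'|.
    rewrite (distrC (f a)); apply: le_trans (ler_distD (f a') _ _) _.
    by rewrite lerD2r; exact: ler_distD.
  lra.
Qed.

Lemma limit_set_bounded_variation (R : realType) (U : set_system nat)
    (UU : UltraFilter U) (A : nat -> seq R) (f : R -> R) (C : R) :
  continuous f -> (forall m, chains_bounded f (A m) C) ->
  forall a l, path <%R a l -> {in a :: l, forall x, limit_set U A x} ->
  chain_variation f a l <= C.
Proof.
move=> cf AC a l al aA; apply/ler_addgt0Pr => e e0.
have [m [a' [l' [al' lA' _ _ H]]]] := @filter_ex _ _ _ _ (limit_set_chain UU cf al aA e0).
by apply: le_trans H _; rewrite lerD2r; exact: (AC m a' l' al' lA').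
Qed.

Lemma count_grid_ball (R : realType) (M n : nat) (x r : R) : (0 < M)%N ->
  2 * r * M%:R <= n%:R ->
  (count (fun y : R => `|x - y| < r)%R [seq i%:R / M%:R | i <- iota 0 M] <= n)%N.
Proof.
move=> M0 rn; rewrite count_map -size_filter.
set F := seq.filter _ _.
have M0' : 0 < M%:R :> R by rewrite ltr0n.
have FP i : i \in F -> `|x - i%:R / M%:R| < r by rewrite mem_filter => /andP[].
have uF : uniq F by rewrite filter_uniq// iota_uniq.
have sF : sorted ltn F by apply: sorted_filter; [exact: ltn_trans|exact: iota_ltn_sorted].
case: F uF sF FP => [//|i0 F'] uF sF FP.
rewrite -[leqRHS](size_iota i0); apply: uniq_leq_size => // i iF.
have i0i : (i0 <= i)%N.
  move: iF; rewrite inE => /predU1P[->//|iF].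
  by have /allP/(_ _ iF)/ltnW := order_path_min ltn_trans sF.
rewrite mem_iota i0i/= -(ltr_nat R) natrD.
have := FP i iF; have := FP i0 (mem_head _ _).
rewrite !ltr_distl => /andP[_ h1] /andP[h2 _].
have : i%:R / M%:R - i0%:R / M%:R < 2 * r by lra.
by rewrite -mulrBl ltr_pdivrMr// => ?; lra.
Qed.

(** The ratio is log B / log (4 B^2) for B = 2^j. *)
Lemma exists_dim_ge_ratio (R : realType) (j : nat) (alpha : R) (f : R -> R) :
  0 < alpha -> (0 < j)%N -> hoelder01 alpha f ->
  exists A : set R, [/\ A !=set0, A `<=` `[0, 1], bounded_variation_on A f &
    ((j%:R / (2 * j + 2)%:R)%:E <= hausdorff_dim A)%E].
Proof.
move=> a0 j0 /(hoelder01_extend a0)[g [c c0 [gh cg fg]]].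
pose B := (2 ^ j)%N; pose L := (4 * B ^ 2)%N; pose s : R := j%:R / (2 * j + 2)%:R.
have B0 : (0 < B)%N by rewrite expn_gt0.
have B2 : (1 < B)%N by rewrite -(expn0 2) ltn_exp2l.
have L0 : (0 < L)%N by rewrite /L muln_gt0/= expn_gt0 B0.
have L1 : (1 < L)%N by rewrite /L -mulnn; nia.
have s0 : 0 < s by rewrite divr_gt0// ltr0n// addn2.
have Ls : (L%:R : R) `^ s = B%:R.
  have -> : L%:R = 2 `^ (2 * j + 2)%:R :> R.
    rewrite powR_mulrn// -natrX; congr (_%:R).
    by rewrite /L /B -expnM expnD mulnC (mulnC 2 j).
  rewrite -powRrM /s mulrC divfK ?pnatr_eq0 ?addn2// powR_mulrn// -natrX//.
pose E m : seq R := [seq i%:R / (L ^ m)%:R | i <- iota 0 (L ^ m)].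
have Lm0 m : 0 < (L ^ m)%:R :> R by rewrite ltr0n expn_gt0 L0.
have E01 m y : y \in E m -> 0 <= y <= 1.
  move=> /mapP[i]; rewrite mem_iota add0n => /andP[_ iL] ->.
  by rewrite divr_ge0 ?ler0n//= ler_pdivrMr// mul1r ler_nat ltnW.
have thin m : exists A, [/\ subseq A (E m), size A = (B ^ m)%N,
    chains_bounded g A ((2 * c) *+ (2 * B)) &
    forall (P : pred R) (k : nat), convex_pred P -> (k <= m)%N ->
      (count P (E m) <= L ^ k)%N -> (count P A <= B ^ k)%N].
  apply: (@thin_chain R g B B0 m (E m) (g 0 - c) (2 * c)).
  - by rewrite mulr_ge0// ltW.
  - rewrite sorted_map; apply: (@sub_sorted _ ltn); last exact: iota_ltn_sorted.
    by move=> x y xy; rewrite /= ltr_pM2r ?invr_gt0// ltr_nat.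
  - by rewrite size_map size_iota.
  - move=> y /E01/andP[y0 y1].
    have : `|g y - g 0| <= c.
      apply: le_trans (gh _ _) _; rewrite ler_piMr ?(ltW c0)// subr0 ger0_norm//.
      apply: (@le_trans _ _ (1 `^ alpha)); last by rewrite powR1.
      by apply: ge0_ler_powR; rewrite ?nnegrE ?(ltW a0).
    by rewrite ler_distl => /andP[? ?]; lra.
have [A HA] := choice thin.
have A01 m y : y \in A m -> 0 <= y <= 1.
  by have [/mem_subseq AE _ _ _] := HA m; move=> /AE/E01.
have [U [UU Uoo]] := ultraFilterLemma (@eventually_filter).
exists (limit_set U A); split.
- apply/set0P/negP => /eqP S0.
  have /= := limit_set_open_cover UU A01 open0; rewrite S0 => /(_ (fun x => id)).
  move=> /filter_ex[m /= Hm]; have [_ nA _ _] := HA m.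
  case eA : (A m) nA Hm => [|y l] nA Hm.
    by move/esym/eqP: nA; rewrite expn_eq0 (gtn_eqF B0).
  exact: (Hm y (mem_head _ _)).
- exact: limit_set_itv.
- apply: (@bounded_variation_on_intro _ _ _ ((2 * c) *+ (2 * B))) => a l al lS.
  have -> : chain_variation f a l = chain_variation g a l.
    by apply: eq_chain_variation => x /lS/(limit_set_itv UU A01); exact: fg.
  by apply: (limit_set_bounded_variation UU cg _ al lS) => m; have [] := HA m.
rewrite leNgt; apply/negP => dS.
(* The first bound makes the radii at most 1/2; the second one makes the balls
   too few to contain the B^m points of A m. *)
pose e := Num.min (2^-1 `^ s) ((4 * B%:R * 2 `^ s)^-1).
have p0 : 0 < 4 * B%:R * 2 `^ s by rewrite !mulr_gt0 ?ltr0n// powR_gt0.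
have e0 : 0 < e by rewrite lt_min powR_gt0 ?invr_gt0.
have [n [x [r [r0 Sr sr]]]] :=
  finite_ball_cover_of_hausdorff_dim_lt (limit_set_compact UU A01) s0 dS e0.
have r2 i : (i < n)%N -> 2 * r i <= 1.
  move=> ni; rewrite leNgt; apply/negP => r1.
  have : 2^-1 `^ s < r i `^ s.
    by apply: gt0_ltr_powR; rewrite ?nnegrE ?invr_ge0 ?(ltW (r0 _))//; lra.
  apply/negP; rewrite -leNgt; apply: (@le_trans _ _ e); last by rewrite ge_min lexx.
  apply: le_trans sr; rewrite (bigD1 (Ordinal ni))//= lerDl.
  by apply: sumr_ge0 => *; exact: powR_ge0.
have scale i : exists k, (i < n)%N -> ((L%:R : R) ^+ k.+1)^-1 < 2 * r i <= (L%:R ^+ k)^-1.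
  have [ni|] := ltnP i n; last by exists 0%N.
  have [||k Hk] := @exists_scale R L%:R (2 * r i).
  - by rewrite ltr1n.
  - by rewrite mulr_gt0// r2.
  - by exists k.
have [k Hk] := choice scale.
have oV : open (\bigcup_(i in [set i | (i < n)%N]) ball (x i) (r i)).
  by apply: bigcup_open => i _; exact: ball_open.
have SV : limit_set U A `<=` \bigcup_(i in [set i | (i < n)%N]) ball (x i) (r i).
  by move=> y /Sr[i ni yi]; exists i => //; rewrite -ball_normE.
have UV := limit_set_open_cover UU A01 oV SV.
have Uk : U [set m | (\max_(i < n) k i <= m)%N] by apply: Uoo; exists (\max_(i < n) k i)%N.
have [m [/= Vm km]] := @filter_ex _ _ _ _ (filterI UV Uk).
have [_ nA _ PA] := HA m.
pose P i (y : R) := `|x i - y| < r i.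
have cA : (size (A m) <= \sum_(i < n) count (P i) (A m))%N.
  have : {in A m, forall y, exists2 i, (i < n)%N & P i y}.
    by move=> y /Vm[i /= ni]; rewrite -ball_normE; exists i.
  elim: (A m) => [//|y l IH] H /=; rewrite big_split/= -add1n leq_add//.
    have [i ni Piy] := H y (mem_head _ _).
    by rewrite (bigD1 (Ordinal ni))//= Piy.
  by apply: IH => z zl; apply: H; rewrite inE zl orbT.
have cP i : (i < n)%N -> (count (P i) (A m))%:R <= B%:R ^+ m * (B%:R * 2 `^ s * r i `^ s).
  move=> ni; have /andP[k1 k2] := Hk i ni.
  have kim : (k i <= m)%N by apply: leq_trans km; exact: (leq_bigmax (Ordinal ni)).
  have : (count (P i) (A m) <= B ^ (m - k i))%N.
    apply: PA; last 2 first.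
    - exact: leq_subr.
    - apply: count_grid_ball; first by rewrite expn_gt0 L0.
      rewrite !natrX -ler_pdivlMr ?exprn_gt0 ?ltr0n//.
      apply: le_trans k2 _; rewrite -{2}(subnK kim) exprD invfM mulrA divff ?mul1r//.
      by rewrite expf_eq0 pnatr_eq0 (gtn_eqF L0) andbF.
    move=> y1 y2 y3 y12 y23; rewrite /P !ltr_distl => /andP[? ?] /andP[? ?].
    by apply/andP; split; lra.
  rewrite -(ler_nat R) natrX => H; apply: le_trans H _.
  have Bn0 t : 0 < (B%:R : R) ^+ t by rewrite exprn_gt0// ltr0n.
  rewrite -{2}(subnK kim) exprD -mulrA ler_peMr ?(ltW (Bn0 _))//.
  rewrite -ler_pdivrMl// mulr1 -mulrA -powRM ?(ltW (r0 i))//.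
  rewrite -ler_pdivrMl ?ltr0n// -invfM -exprS -Ls.
  have -> : ((L%:R : R) `^ s ^+ (k i).+1)^-1 = ((L%:R ^+ (k i).+1)^-1) `^ s.
    by rewrite -!powR_mulrn ?powR_ge0 ?ler0n// -!powRN -!powRrM; congr (_ `^ _); lra.
  apply/ltW/gt0_ltr_powR => //; rewrite nnegrE.
    by rewrite invr_ge0 exprn_ge0.
  by rewrite mulr_ge0// ltW.
move: cA; rewrite nA -(ler_nat R) natr_sum natrX; apply/negP; rewrite -ltNge.
apply: (@le_lt_trans _ _ (\sum_(i < n) B%:R ^+ m * (B%:R * 2 `^ s * r i `^ s))).
  by apply: ler_sum => i _; exact: cP.
rewrite -!mulr_sumr -[ltRHS]mulr1 ltr_pM2l ?exprn_gt0 ?ltr0n//.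
apply: (@le_lt_trans _ _ (B%:R * 2 `^ s * e)).
  by rewrite ler_pM2l// mulr_gt0 ?ltr0n// powR_gt0.
apply: (@le_lt_trans _ _ (B%:R * 2 `^ s * (4 * B%:R * 2 `^ s)^-1)).
  by rewrite ler_pM2l ?mulr_gt0 ?ltr0n ?powR_gt0// ge_min lexx orbT.
rewrite ltr_pdivrMr// mul1r -mulrA ltr_pMl ?ltr1n//.
by rewrite mulr_gt0 ?ltr0n// powR_gt0.
Qed.

(** * A self-affine function with few chains of bounded variation *)

Section zigzag.
Context {R : realType} (r q : nat) (r0 : (0 < r)%N) (q0 : (0 < q)%N) (oq : odd q).
Let N := (r * q)%N.
Let N0 : (0 < N)%N. Proof. by rewrite muln_gt0 r0. Qed.

(** Height after [d] steps of the path that goes up and down [q] times in row 0,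
    then [q] times in row 1, and so on; as [q] is odd, it leaves each row at the
    top. *)
Definition zigzag (d : nat) : nat := (d %/ q + odd (d %% q))%N.

Lemma zigzag_row (d : nat) : (d %/ q <= zigzag d <= (d %/ q).+1)%N.
Proof. by rewrite /zigzag leq_addr/= -addn1 leq_add2l leq_b1. Qed.

Lemma zigzagS (d : nat) :
  (zigzag d = d %/ q /\ zigzag d.+1 = (d %/ q).+1 \/
   zigzag d = (d %/ q).+1 /\ zigzag d.+1 = d %/ q)%N.
Proof.
have dq := divn_eq d q; have jq := ltn_pmod d q0.
rewrite /zigzag; move: (d %/ q)%N (d %% q)%N dq jq => p j -> jq.
have [jq1|jq1] := ltnP j.+1 q.
  rewrite -addnS divnMDl// modnMDl divn_small// modn_small// addn0 /=.
  by case: (odd j); [right|left]; rewrite ?addn0 ?addn1.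
have eq1 : j.+1 = q by apply/eqP; rewrite eqn_leq jq.
left; rewrite -addnS eq1 divnMDl// modnMDl divnn q0 modnn addn0 addn1; split => //.
by move: oq; rewrite -eq1 /= => /negPf ->; rewrite addn0.
Qed.

Lemma zigzag_end : zigzag N = r.
Proof. by rewrite /zigzag /N mulnK// modnMl addn0. Qed.

(** Height of the [n]-th vertex of the depth-[k] path, in units of depth-[k] rows:
    each step of depth [k] is replaced by a copy of the zigzag, turned upside
    down if the step goes down. *)
Fixpoint height (k n : nat) : R :=
  if k is k'.+1 then
    r%:R * height k' (n %/ N) +
    (height k' (n %/ N).+1 - height k' (n %/ N)) * (zigzag (n %% N))%:R
  else n%:R.

Lemma height_refine (k m d : nat) : (d <= N)%N ->
  height k.+1 (m * N + d) =
  r%:R * height k m + (height k m.+1 - height k m) * (zigzag d)%:R.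
Proof.
rewrite leq_eqVlt => /predU1P[->|dN]; last first.
  by rewrite /= divnMDl// modnMDl divn_small// modn_small// addn0.
rewrite -mulSnr /= mulnK// modnMl zigzag_end /zigzag div0n mod0n /=.
by rewrite mulr0 addr0; ring.
Qed.

Lemma height_step (k n : nat) :
  height k n.+1 - height k n = 1 \/ height k n.+1 - height k n = -1.
Proof.
elim: k n => [|k IH] n; first by left; rewrite /= -natr1 addrAC subrr add0r.
rewrite (divn_eq n N) -addnS.
have dN := ltn_pmod n N0.
rewrite (height_refine _ _ dN) (height_refine _ _ (ltnW dN)).
have [s|s] := IH (n %/ N)%N; rewrite s; have [[-> ->]|[-> ->]] := zigzagS (n %% N);
  rewrite -natr1; by [left; ring|right; ring].
Qed.

Definition column (k : nat) (x : R) : nat := Num.truncn (N%:R ^+ k * x).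

Lemma column_itv (k : nat) (x : R) : 0 <= x ->
  (column k x)%:R <= N%:R ^+ k * x < (column k x).+1%:R.
Proof. by move=> x0; apply: truncn_itv; rewrite mulr_ge0. Qed.

Lemma column_parent (k : nat) (x : R) : 0 <= x -> (column k.+1 x %/ N)%N = column k x.
Proof.
move=> x0; apply/esym/truncn_def.
have /andP[h1 h2] := column_itv k.+1 x0.
have N0' : 0 < N%:R :> R by rewrite ltr0n.
move: h1 h2; rewrite exprS -mulrA => h1 h2.
have := divn_eq (column k.+1 x) N; have := ltn_pmod (column k.+1 x) N0.
move: (_ %/ _)%N (_ %% _)%N => m d dN e.
apply/andP; split.
  rewrite -(ler_pM2l N0'); apply: le_trans h1; rewrite -natrM ler_nat e mulnC.
  exact: leq_addr.
rewrite -(ltr_pM2l N0'); apply: lt_le_trans h2 _; rewrite -natrM ler_nat e.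
by rewrite mulnS (mulnC N m) -addnS addnC leq_add2r.
Qed.

Let lower (k : nat) (x : R) : R :=
  Num.min (height k (column k x)) (height k (column k x).+1) / r%:R ^+ k.
Let upper (k : nat) (x : R) : R :=
  Num.max (height k (column k x)) (height k (column k x).+1) / r%:R ^+ k.

(** The limit of the piecewise linear functions with vertices [height k n]: the
    vertical extents of the depth-[k] steps above [x] are nested intervals, and
    the supremum of their lower ends is their common point. *)
Definition zigzag_limit (x : R) : R := sup [set lower k x | k in [set: nat]].

Let rk0 (k : nat) : 0 < r%:R ^+ k :> R.
Proof. by rewrite exprn_gt0// ltr0n. Qed.

Let heightS (k n : nat) : exists2 e : R, e = 1 \/ e = -1 &
  height k n.+1 = height k n + e.
Proof.
by exists (height k n.+1 - height k n); [exact: height_step|rewrite addrC subrK].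
Qed.

Let min_max_refine (v e z1 z2 : R) : e = 1 \/ e = -1 ->
  0 <= z1 <= r%:R -> 0 <= z2 <= r%:R ->
  r%:R * Num.min v (v + e) <= Num.min (r%:R * v + e * z1) (r%:R * v + e * z2) /\
  Num.max (r%:R * v + e * z1) (r%:R * v + e * z2) <= r%:R * Num.max v (v + e).
Proof.
move=> e1 /andP[? ?] /andP[? ?]; rewrite le_min ge_max.
case: e1 => ->.
  by rewrite min_l ?max_r ?lerDl//; split; apply/andP; split; lra.
by rewrite min_r ?max_l ?gerBl//; split; apply/andP; split; lra.
Qed.

Let lowerE (k : nat) (x : R) :
  lower k x * r%:R ^+ k = Num.min (height k (column k x)) (height k (column k x).+1).
Proof. by rewrite /lower divfK// gt_eqF. Qed.

Let upperE (k : nat) (x : R) :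
  upper k x * r%:R ^+ k = Num.max (height k (column k x)) (height k (column k x).+1).
Proof. by rewrite /upper divfK// gt_eqF. Qed.

Let column_split (k : nat) (x : R) : 0 <= x ->
  exists2 d, (d < N)%N & column k.+1 x = (column k x * N + d)%N.
Proof.
move=> x0; exists (column k.+1 x %% N)%N; first exact: ltn_pmod.
by rewrite -(column_parent k x0) -divn_eq.
Qed.

Let nested (k : nat) (x : R) : 0 <= x ->
  lower k x <= lower k.+1 x /\ upper k.+1 x <= upper k x.
Proof.
move=> x0; rewrite -(ler_pM2r (rk0 k.+1)) -[upper _ _ <= _](ler_pM2r (rk0 k.+1)) lowerE upperE.
rewrite exprS mulrCA lowerE mulrCA upperE.
have [d dN ->] := column_split k x0.
rewrite -addnS (height_refine _ _ dN) (height_refine _ _ (ltnW dN)).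
have [z1 z2] : (zigzag d <= r)%N /\ (zigzag d.+1 <= r)%N.
  have dr : (d %/ q < r)%N by rewrite ltn_divLR.
  by have [[-> ->]|[-> ->]] := zigzagS d; split => //; exact: ltnW.
have [e e1 ->] := heightS k (column k x).
have -> : height k (column k x) + e - height k (column k x) = e by ring.
by apply: min_max_refine => //; rewrite ler0n ler_nat.
Qed.

Let lower_le_upper (k j : nat) (x : R) : 0 <= x -> lower k x <= upper j x.
Proof.
move=> x0; have lu i : lower i x <= upper i x.
  by rewrite -(ler_pM2r (rk0 i)) lowerE upperE ge_min le_max lexx.
have [|jk] := leqP k j.
  move=> /subnK <-; elim: (j - k)%N => [|i IH]; first exact: lu.
  have lo : lower k x <= lower (i.+1 + k) x.
    by elim: i.+1 => // n IHn; apply: le_trans IHn _; have [] := nested (n + k) x0.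
  exact: le_trans lo (lu _).
have up : upper k x <= upper j x.
  rewrite -(subnK (ltnW jk)); elim: (k - j)%N => // n IHn.
  by apply: le_trans IHn; have [] := nested (n + j) x0.
exact: le_trans (lu _) up.
Qed.

Lemma zigzag_limit_itv (k : nat) (x : R) : 0 <= x ->
  Num.min (height k (column k x)) (height k (column k x).+1)
    <= zigzag_limit x * r%:R ^+ k <=
  Num.max (height k (column k x)) (height k (column k x).+1).
Proof.
move=> x0; rewrite -lowerE -upperE !ler_pM2r//; apply/andP; split.
  apply: ub_le_sup; last by exists k.
  by exists (upper 0 x) => _ [j _ <-]; exact: lower_le_upper.
by apply: ge_sup; [exists (lower 0 x), 0%N|move=> _ [j _ <-]; exact: lower_le_upper].
Qed.

(** Inside a column crossed with slope sign [e], the position [t] of the value is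
    known up to one row from the index of the column of depth [k + 1], of which
    there are [q] per row. *)
Lemma zigzag_limit_row (k : nat) (x : R) (e : R) : 0 <= x -> e = 1 \/ e = -1 ->
  height k (column k x).+1 = height k (column k x) + e ->
  exists2 t, (column k.+1 x %/ q %% r)%:R <= t <= (column k.+1 x %/ q %% r).+1%:R &
    zigzag_limit x * r%:R ^+ k.+1 = r%:R * height k (column k x) + e * t.
Proof.
move=> x0 e1 he.
have := zigzag_limit_itv k.+1 x0.
have [d dN cd] := column_split k x0.
have -> : (column k.+1 x %/ q %% r = d %/ q)%N by rewrite modn_divl cd modnMDl modn_small.
rewrite cd -addnS (height_refine _ _ dN) (height_refine _ _ (ltnW dN)) he.
have -> : height k (column k x) + e - height k (column k x) = e by ring.
move: (zigzag_limit x * _) (r%:R * height _ _) => F v HF.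
exists (e * (F - v)); last by case: e1 => ->; ring.
move: HF; have [[-> ->]|[-> ->]] := zigzagS d; case: e1 => ->; rewrite -natr1.
- rewrite min_l ?max_r; lra.
- rewrite min_r ?max_l; lra.
- rewrite min_r ?max_l; lra.
- rewrite min_l ?max_r; lra.
Qed.

(** Rows are indexed globally by [column k.+1 x %/ q]; two rows that are not
    adjacent are separated by a full row. *)
Lemma zigzag_limit_row_gap (k : nat) (x y : R) : 0 <= x -> 0 <= y ->
  column k x = column k y ->
  (column k.+1 x %/ q + 2 <= column k.+1 y %/ q)%N ->
  (r%:R ^+ k.+1)^-1 <= `|zigzag_limit x - zigzag_limit y|.
Proof.
move=> x0 y0 cxy gap.
have [e e1 he] := heightS k (column k x).
have [t ht ex] := zigzag_limit_row x0 e1 he.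
have he' : height k (column k y).+1 = height k (column k y) + e by rewrite -cxy.
have [t' ht' ey] := zigzag_limit_row y0 e1 he'.
have gap' : (column k.+1 x %/ q %% r + 2 <= column k.+1 y %/ q %% r)%N.
  have px := divn_eq (column k.+1 x %/ q) r; have py := divn_eq (column k.+1 y %/ q) r.
  move: px py; rewrite -!divnMA (mulnC q r) -/N !column_parent// cxy => px py.
  by rewrite -(leq_add2l (column k y * r)) addnA -px -py.
have tt : 1 <= t' - t.
  move: ht ht' gap' => /andP[_ h1] /andP[h2 _].
  rewrite -(ler_nat R) natrD -natr1 => h3; rewrite -natr1 in h1.
  by lra.
rewrite -(ler_pM2r (rk0 k.+1)) mulVf ?gt_eqF// -(ger0_norm (ltW (rk0 k.+1))).
rewrite -normrM mulrBl ex ey cxy.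
have -> : r%:R * height k (column k y) + e * t - (r%:R * height k (column k y) + e * t')
  = e * (t - t') by ring.
rewrite normrM distrC; have -> : `|e| = 1 by case: e1 => ->; rewrite ?normrN normr1.
by rewrite mul1r (le_trans tt)// ler_norm.
Qed.

(** Points at this distance lie in the same or in adjacent columns, so that both
    values are within one row height of a common vertex. *)
Lemma zigzag_limit_modulus (k : nat) (x y : R) : 0 <= x -> 0 <= y ->
  `|x - y| <= (N%:R ^+ k)^-1 ->
  `|zigzag_limit x - zigzag_limit y| <= 2 / r%:R ^+ k.
Proof.
wlog xy : x y / x <= y.
  move=> H x0 y0; have [xy|/ltW yx] := leP x y; first exact: (H x y xy x0 y0).
  by rewrite distrC [in X in _ -> X]distrC; exact: (H y x yx y0 x0).
move=> x0 y0; rewrite distrC ger0_norm ?subr_ge0// => yx.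
have Nk0 : 0 < N%:R ^+ k :> R by rewrite exprn_gt0// ltr0n.
have cxy : (column k y = column k x \/ column k y = (column k x).+1)%N.
  have /andP[x1 x2] := column_itv k x0; have /andP[y1 y2] := column_itv k y0.
  have yx' : N%:R ^+ k * y <= N%:R ^+ k * x + 1.
    by rewrite -(ler_pM2l Nk0) divff ?gt_eqF// in yx; lra.
  have xy' : N%:R ^+ k * x <= N%:R ^+ k * y by rewrite ler_pM2l.
  have : (column k x < (column k y).+1)%N.
    by rewrite -(ltr_nat R); lra.
  have : (column k y < (column k x).+2)%N.
    by rewrite -(ltr_nat R) -natr1; lra.
  by move: (column k x) (column k y); clear; lia.
rewrite ler_pdivlMr// -(ger0_norm (ltW (rk0 k))) -normrM mulrBl ler_norml.
have := zigzag_limit_itv k x0; have := zigzag_limit_itv k y0.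
have minmax (u v w : R) : Num.min u v <= w <= Num.max u v -> `|v - u| = 1 ->
    `|w - v| <= 1 /\ `|w - u| <= 1.
  move=> uvw; have [uv|vu] := leP u v; move: uvw.
    rewrite min_l// max_r// ger0_norm ?subr_ge0// => ? ?.
    by rewrite !ler_norml; lra.
  rewrite (min_r (ltW vu)) (max_l (ltW vu)) ltr0_norm ?subr_lt0// => ? ?.
  by rewrite !ler_norml; lra.
have dist1 n : `|height k n.+1 - height k n| = 1.
  by have [->|->] := height_step k n; rewrite ?normrN normr1.
move=> Hy Hx; have [] := minmax _ _ _ Hx (dist1 _); rewrite ler_norml => {}Hx _.
have : `|zigzag_limit y * r%:R ^+ k - height k (column k x).+1| <= 1.
  case: cxy => cy; rewrite cy in Hy.
    have [h _] := minmax _ _ _ Hy (dist1 _); exact: h.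
  have [_ h] := minmax _ _ _ Hy (dist1 _); exact: h.
by rewrite ler_norml; lra.
Qed.

Lemma zigzag_limit_hoelder (alpha beta : R) : (1 < r)%N -> 0 < alpha <= beta ->
  (N%:R : R) `^ beta = r%:R -> hoelder01 alpha zigzag_limit.
Proof.
move=> r1 /andP[a0 ab] Nb; exists (2 * r%:R); first by rewrite mulr_gt0// ltr0n.
move=> x y; rewrite !in_itv/= => /andP[x0 x1] /andP[y0 y1].
have [->|xy] := eqVneq x y.
  by rewrite subrr normr0 mulr_ge0 ?powR_ge0// mulr_ge0.
have d01 : 0 < `|x - y| <= 1.
  by rewrite normr_gt0 subr_eq0 xy ler_norml; lra.
have N1 : 1 < N%:R :> R by rewrite ltr1n (leq_trans r1)// leq_pmulr.
have [k /andP[k1 k2]] := exists_scale N1 d01.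
apply: le_trans (zigzag_limit_modulus x0 y0 k2) _.
have d0 : 0 <= `|x - y| by [].
apply: (@le_trans _ _ (2 * r%:R * `|x - y| `^ beta)); last first.
  by rewrite ler_pM2l ?mulr_gt0 ?ltr0n//; exact: ger_powR.
rewrite -mulrA ler_pM2l// -ler_pdivrMl ?ltr0n// -invfM -exprS -Nb.
have -> : ((N%:R : R) `^ beta ^+ k.+1)^-1 = ((N%:R ^+ k.+1)^-1) `^ beta.
  by rewrite -!powR_mulrn ?powR_ge0 ?ler0n// -!powRN -!powRrM; congr (_ `^ _); lra.
apply/ltW/gt0_ltr_powR => //; rewrite ?nnegrE ?invr_ge0 ?exprn_ge0//.
exact: lt_le_trans a0 ab.
Qed.

End zigzag.

(** * Counting columns *)

Lemma size_le_undup (T : eqType) (s t : seq T) :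
  uniq s -> {subset s <= t} -> (size s <= size (undup t))%N.
Proof. by move=> us st; apply: uniq_leq_size => // x /st; rewrite mem_undup. Qed.

(** Here [c :: cs] lists rows and [i %/ r] is the column of row [i].  The chain is
    read two steps at a time: either the two steps stay in one column and cost at
    least [d], or a new column is entered. *)
Lemma size_le_chain_variation (R : realType) (r : nat) (f : R -> R) (x : nat -> R)
    (d : R) (c : nat) (cs : seq nat) :
  0 <= d -> path ltn c cs ->
  (forall i j, i \in c :: cs -> j \in c :: cs -> (i %/ r = j %/ r)%N ->
     (i + 2 <= j)%N -> d <= `|f (x i) - f (x j)|) ->
  d *+ (size (c :: cs)) <=
  chain_variation f (x c) (map x cs) *+ 2 +
  d *+ (2 * size (undup [seq (i %/ r)%N | i <- c :: cs])).
Proof.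
move=> d0; move: {2}(size cs) (leqnn (size cs)) => n.
elim: n c cs => [|n IH] c [|c1 [|c2 cs]] // nl pcs gap.
- by rewrite /= mul0rn add0r ler_wpMn2l.
- by rewrite /= mul0rn add0r ler_wpMn2l.
- have D0 : (0 < size (undup [seq (i %/ r)%N | i <- [:: c; c1]]))%N.
    by apply: (@size_le_undup _ [:: (c %/ r)%N]) => // y; rewrite !inE => ->.
  apply: ler_wpDl; first by rewrite mulrn_wge0// chain_variation_ge0.
  by rewrite ler_wpMn2l//; exact: leq_pmulr.
have /and3P[cc1 c12 {}pcs] : [&& c < c1, c1 < c2 & path ltn c2 cs]%N := pcs.
have mem2 i : i \in c2 :: cs -> i \in [:: c, c1, c2 & cs] by rewrite !inE => ->; rewrite !orbT.
have {}IH : d *+ size (c2 :: cs) <= chain_variation f (x c2) (map x cs) *+ 2 +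
    d *+ (2 * size (undup [seq (i %/ r)%N | i <- c2 :: cs])).
  apply: IH => //; first by move: nl; rewrite /=; lia.
  by move=> i j /mem2 hi /mem2 hj; exact: gap.
set D2 := size (undup [seq (i %/ r)%N | i <- c2 :: cs]) in IH.
set D := size (undup [seq (i %/ r)%N | i <- [:: c, c1, c2 & cs]]).
set w := chain_variation f (x c2) (map x cs) in IH.
have -> : chain_variation f (x c) (map x [:: c1, c2 & cs]) =
    `|f (x c1) - f (x c)| + `|f (x c2) - f (x c1)| + w by rewrite -addrA.
have w0 : 0 <= w by exact: chain_variation_ge0.
have a0 : 0 <= `|f (x c1) - f (x c)| + `|f (x c2) - f (x c1)| by rewrite addr_ge0.
have -> : size [:: c, c1, c2 & cs] = (2 + size (c2 :: cs))%N by [].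
rewrite mulrnDr mulrnDl.
have [e|ne] := eqVneq (c %/ r)%N (c2 %/ r)%N.
  (* The indices increase strictly, so that c + 2 <= c2. *)
  have d2 : d <= `|f (x c1) - f (x c)| + `|f (x c2) - f (x c1)|.
    apply: (le_trans (gap c c2 _ _ e _)); rewrite ?inE ?eqxx ?orbT//; first lia.
    by rewrite distrC [leRHS]addrC; exact: ler_distD.
  have DD : d *+ (2 * D2) <= d *+ (2 * D).
    rewrite ler_wpMn2l// leq_mul2l/=; apply: size_le_undup; first exact: undup_uniq.
    by move=> y; rewrite mem_undup => /mapP[i /mem2 i2 ->]; exact: (map_f (fun i => i %/ r)%N i2).
  rewrite -[leRHS]addrA; apply: lerD; first by rewrite lerMn2r.
  by apply: le_trans IH _; rewrite lerD2l.
have DD : (D2 + 1 <= D)%N.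
  rewrite addn1; apply: (@size_le_undup _ ((c %/ r)%N :: undup [seq (i %/ r)%N | i <- c2 :: cs])).
    rewrite cons_uniq undup_uniq andbT mem_undup; apply/negP.
    have cr : (c %/ r <= c2 %/ r)%N by rewrite leq_div2r//; lia.
    move=> /mapP[i i2 ei]; have c2i : (c2 <= i)%N.
      move: i2; rewrite inE => /predU1P[->//|i2].
      by have /allP/(_ _ i2)/ltnW := order_path_min ltn_trans pcs.
    by move/eqP: ne; apply; apply/eqP; rewrite eqn_leq cr ei leq_div2r.
  move=> y; rewrite inE mem_undup => /predU1P[->|/mapP[i /mem2 i2 ->]]; last exact: (map_f (fun i => i %/ r)%N i2).
  exact: (map_f (fun i => i %/ r)%N (mem_head _ _)).
have DD' : d *+ (2 * D2) + d *+ 2 <= d *+ (2 * D).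
  by rewrite -mulrnDr ler_wpMn2l//; lia.
apply: (@le_trans _ _ (w *+ 2 + (d *+ (2 * D2) + d *+ 2))).
  by rewrite [leLHS]addrC [leRHS]addrA; exact: lerD.
by rewrite -[leRHS]addrA ler_wpDl ?mulrn_wge0// lerD2l.
Qed.

Section count_columns.
Context {R : realType} (r q : nat) (r0 : (0 < r)%N) (q0 : (0 < q)%N) (oq : odd q).
Let N := (r * q)%N.
Variables (A : set R) (A01 : A `<=` `[0, 1]).

Definition hit_columns (k : nat) : seq nat :=
  [seq i <- iota 0 (N ^ k).+1 | `[< exists2 x, A x & column r q k x = i >]].

Lemma mem_hit_columns (k i : nat) :
  (i \in hit_columns k) = `[< exists2 x, A x & column r q k x = i >].
Proof.
rewrite mem_filter; case: asboolP => // -[x Ax <-]; rewrite andTb.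
have /andP[x0 x1] : 0 <= x <= 1 by have := A01 Ax; rewrite /= in_itv.
rewrite mem_iota leq0n add0n ltnS andTb -(ler_nat R) natrX.
have /andP[h _] := column_itv r q k x0; apply: le_trans h _.
by rewrite ler_piMr// exprn_ge0.
Qed.

(** One point of [A] is chosen in each row that it meets; the resulting chain is
    fed to [size_le_chain_variation]. *)
Lemma size_hit_columns (C : R) (k : nat) : 0 <= C ->
  (forall a l, path <%R a l -> {in a :: l, forall x, A x} ->
     chain_variation (zigzag_limit r q : R -> R) a l <= C) ->
  (size (hit_columns k.+1))%:R <=
    q%:R * (2 * C * r%:R ^+ k.+1 + 2 * (size (hit_columns k))%:R) :> R.
Proof.
move=> C0 AC; set f : R -> R := zigzag_limit r q in AC.
have N0 : (0 < N)%N by rewrite muln_gt0 r0.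
pose rows := [seq c <- iota 0 (N ^ k.+1).+1 | has (fun i => i %/ q == c)%N (hit_columns k.+1)].
have rowsP c : c \in rows -> exists2 x, A x & (column r q k.+1 x %/ q = c)%N.
  rewrite mem_filter => /andP[/hasP[i]]; rewrite mem_hit_columns => /asboolP[x Ax <-] /eqP <- _.
  by exists x.
have mem_rows x : A x -> (column r q k.+1 x %/ q)%N \in rows.
  move=> Ax; have hx : column r q k.+1 x \in hit_columns k.+1.
    by rewrite mem_hit_columns; apply/asboolP; exists x.
  rewrite mem_filter; apply/andP; split; first by apply/hasP; exists (column r q k.+1 x).
  move: hx; rewrite mem_filter => /andP[_]; rewrite !mem_iota !leq0n !add0n !andTb.
  by apply: leq_ltn_trans; exact: leq_div.
have cols : (size (hit_columns k.+1) <= q * size rows)%N.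
  rewrite mulnC -[X in (_ * X)%N](size_iota 0 q).
  rewrite -(size_allpairs (fun c j => c * q + j)%N rows).
  apply: uniq_leq_size; first by rewrite filter_uniq// iota_uniq.
  move=> i; rewrite mem_hit_columns => /asboolP[x Ax ex].
  apply/allpairsP; exists (i %/ q, i %% q)%N; split => /=; last exact: divn_eq.
    by rewrite -ex mem_rows.
  by rewrite mem_iota add0n ltn_mod.
have [xr xrP] : {xr : nat -> R | forall c, c \in rows ->
    A (xr c) /\ (column r q k.+1 (xr c) %/ q = c)%N}.
  exists (fun c => xget 0 [set x | A x /\ (column r q k.+1 x %/ q = c)%N]) => c.
  by move=> /rowsP[x Ax ex]; case: xgetP => [y -> []//|/(_ x)]; case.
have A0 x : A x -> 0 <= x by move=> /A01 /=; rewrite in_itv/= => /andP[].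
have rk0 : 0 < r%:R ^+ k.+1 :> R by rewrite exprn_gt0// ltr0n.
have size_rows : (size rows)%:R <= 2 * C * r%:R ^+ k.+1 + 2 * (size (hit_columns k))%:R :> R.
  case er : rows => [|c cs]; first by rewrite addr_ge0 ?mulr_ge0 ?exprn_ge0.
  have srt : sorted ltn (c :: cs).
    by rewrite -er; apply: sorted_filter; [exact: ltn_trans|exact: iota_ltn_sorted].
  pose d : R := (r%:R ^+ k.+1)^-1.
  have xr_col i : i \in rows -> column r q k (xr i) = (i %/ r)%N.
    move=> hi; have [/A0 h ei] := xrP i hi.
    by rewrite -(column_parent r0 q0 k h) -[in RHS]ei -divnMA (mulnC q).
  have xr_lt i j : i \in rows -> j \in rows -> (i < j)%N -> xr i < xr j.
    move=> /xrP[/A0 hi ei] /xrP[/A0 hj ej] ij; rewrite ltNge; apply/negP => ji.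
    have : (column r q k.+1 (xr j) <= column r q k.+1 (xr i))%N.
      by apply: le_truncn; rewrite ler_pM2l// exprn_gt0// ltr0n.
    by move/(leq_div2r q); rewrite ei ej leqNgt ij.
  have gap i j : i \in c :: cs -> j \in c :: cs -> (i %/ r = j %/ r)%N ->
      (i + 2 <= j)%N -> d <= `|f (xr i) - f (xr j)|.
    rewrite -er => hi hj e ij; have [/A0 pi ei] := xrP i hi; have [/A0 pj ej] := xrP j hj.
    by apply: zigzag_limit_row_gap; rewrite ?ei ?ej// !xr_col.
  have d0 : 0 <= d by rewrite invr_ge0 exprn_ge0.
  have H := size_le_chain_variation d0 srt gap.
  have hC : chain_variation f (xr c) (map xr cs) <= C.
    apply: AC.
      have := homo_sorted_in (P := mem rows) (f := xr) (e := ltn) (e' := <%R) xr_lt.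
      move=> /(_ rows (allss _)); rewrite er; exact.
    move=> y; rewrite -map_cons -er => /mapP[i /xrP[Ai _] ->]; exact: Ai.
  have hD : (size (undup [seq (i %/ r)%N | i <- c :: cs]) <= size (hit_columns k))%N.
    apply: uniq_leq_size; first exact: undup_uniq.
    move=> y; rewrite mem_undup -er => /mapP[i hi ->].
    rewrite mem_hit_columns; apply/asboolP; exists (xr i); last exact: xr_col.
    by have [] := xrP i hi.
  have d1 : 0 < d by rewrite invr_gt0.
  have rd : r%:R ^+ k.+1 * d = 1 by rewrite divff// gt_eqF.
  rewrite -(ler_pM2r d1) mulrDl -[_ * _ * d]mulrA rd mulr1 [leLHS]mulr_natl.
  apply: le_trans H _; apply: lerD; first by rewrite mulr_natl lerMn2r hC.
  by rewrite -natrM mulr_natl ler_wpMn2l// leq_mul2l hD orbT.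
apply: (@le_trans _ _ (q * size rows)%:R); first by rewrite ler_nat.
by rewrite natrM ler_pM2l// ltr0n.
Qed.

(** The constant K = 6 q C + 2 satisfies 2 q C + (2 q / r) K <= K, because
    2 q / r is at most 2 / 3. *)
Lemma size_hit_columns_le (C : R) : 0 <= C -> (3 * q <= r)%N ->
  (forall a l, path <%R a l -> {in a :: l, forall x, A x} ->
     chain_variation (zigzag_limit r q : R -> R) a l <= C) ->
  forall k, (size (hit_columns k))%:R <= (6 * q%:R * C + 2) * r%:R ^+ k :> R.
Proof.
move=> C0 qr AC; elim=> [|k IH].
  rewrite expr0 mulr1; apply: (@le_trans _ _ 2%:R).
    rewrite ler_nat; apply: leq_trans (_ : size (iota 0 (N ^ 0).+1) <= 2)%N => //.
    by rewrite size_filter; exact: count_size.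
  by rewrite lerDr !mulr_ge0.
apply: le_trans (size_hit_columns k C0 AC) _.
have qr' : 3 * q%:R <= r%:R :> R by rewrite -natrM ler_nat.
rewrite exprS; have P0 : 0 <= r%:R ^+ k :> R by rewrite exprn_ge0.
move: (r%:R ^+ k) P0 IH => P P0; move: (_%:R) => s sP.
have h1 : q%:R * s <= q%:R * ((6 * q%:R * C + 2) * P) by rewrite ler_wpM2l.
have h2 : 3 * q%:R * ((6 * q%:R * C + 2) * P) <= r%:R * ((6 * q%:R * C + 2) * P).
  by rewrite ler_wpM2r// mulr_ge0// addr_ge0 ?mulr_ge0.
have h3 : 0 <= r%:R * P by rewrite mulr_ge0.
lra.
Qed.

End count_columns.

(** The columns of depth [k] that meet [A] form a cover whose sum in exponent
    [beta + e] is O(r^k (r q)^(- k (beta + e))) = O((r q)^(- k e)). *)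
Lemma hausdorff_dim_zigzag_le (R : realType) (r q : nat) (beta : R) (A : set R) :
  (0 < q)%N -> odd q -> (3 * q <= r)%N -> 0 < beta ->
  ((r * q)%:R : R) `^ beta = r%:R -> A `<=` `[0, 1] ->
  bounded_variation_on A (zigzag_limit r q) ->
  (hausdorff_dim A <= beta%:E)%E.
Proof.
move=> q0 oq qr b0 Nb A01 /bounded_variation_on_elim[C C0 AC].
have r0 : (0 < r)%N by lia.
set N := (r * q)%N in Nb.
have N1 : 1 < N%:R :> R by rewrite ltr1n /N; nia.
have N0 : 0 < N%:R :> R by rewrite (lt_trans _ N1).
set K := 6 * q%:R * C + 2.
have K0 : 0 < K by rewrite ltr_wpDl// !mulr_ge0.
have count k : (size (hit_columns r q A k))%:R <= K * r%:R ^+ k.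
  exact: size_hit_columns_le.
apply/lee_addgt0Pr => e e0; rewrite -EFinD.
set t := beta + e; have t0 : 0 < t by rewrite addr_gt0.
apply: ereal_inf_lbound; exists t => //=; split; first exact: ltW.
have w0 U : (0 <= hausdorff_weight t U)%E.
  by rewrite /hausdorff_weight; case: ifP => // _; exact: poweR_ge0.
have pre0 d : (0 <= hausdorff_premeasure t d A)%E.
  by apply: le_ereal_inf_tmp => _ [U _ <-]; apply: nneseries_ge0.
apply/eqP; rewrite eq_le; apply/andP; split; last first.
  by apply: le_trans (pre0 1) _; apply: ereal_sup_ubound; exists 1 => //=.
apply: ge_ereal_sup => _ [d /= d0 <-].
apply/lee_addgt0Pr => h h0; rewrite add0e.
have Ne1 : 1 < (N%:R : R) `^ e.
  rewrite -[ltLHS](powRr0 N%:R) /powR gt_eqF// ltr_expR ltr_pM2r ?ln_gt0//.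
have rN k : r%:R ^+ k * ((N%:R : R) ^- k) `^ t = (((N%:R : R) `^ e)^-1) ^+ k.
  rewrite -Nb -!powR_mulrn ?powR_ge0 ?invr_ge0 ?powR_ge0 ?ler0n//.
  rewrite -!powRN -!powRrM -powRD; last by rewrite pnatr_eq0 -lt0n -(ltr_nat R) N0 implybT.
  by congr (_ `^ _); rewrite /t; ring.
have small (y x : R) : 0 <= y < 1 -> 0 < x -> exists k, forall j, (k <= j)%N -> y ^+ j < x.
  move=> /andP[y0 y1] x0.
  have : (fun j => y ^+ j) @ \oo --> (0 : R) by apply: cvg_expr; rewrite ger0_norm.
  move=> /cvgrPdist_lt/(_ x x0)[k _ Hk]; exists k => j kj.
  have := Hk j kj; rewrite /= sub0r normrN; apply: le_lt_trans; exact: ler_norm.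
have [|k1 Hk1] := small ((N%:R : R) `^ e)^-1 (h / K) _ (divr_gt0 h0 K0).
  by rewrite invr_ge0 powR_ge0/= invf_lt1// (lt_trans _ Ne1).
have [|k2 Hk2] := small (N%:R)^-1 d _ d0.
  by rewrite invr_ge0 (ltW N0)/= invf_lt1.
pose j := maxn k1 k2.
have {Hk1} cost : K * ((N%:R : R) `^ e)^-1 ^+ j < h.
  by rewrite mulrC -ltr_pdivlMr// Hk1// leq_maxl.
have {Hk2} mesh : (N%:R : R) ^- j < d.
  by rewrite -exprVn Hk2// leq_maxr.
have Nj0 : 0 < (N%:R : R) ^+ j by rewrite exprn_gt0.
pose U i := A `&` [set x | column r q j x = i].
have diamU i : (diameter (U i) <= ((N%:R : R) ^- j)%:E)%E.
  apply: ge_ereal_sup => _ [[x y] /= [[/A01 /= + ex] [/A01 /= + ey]] <-].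
  rewrite !in_itv/= => /andP[x0 _] /andP[y0 _].
  have /andP[hx1 hx2] := column_itv r q j x0; have /andP[hy1 hy2] := column_itv r q j y0.
  rewrite ex in hx1 hx2; rewrite ey in hy1 hy2; rewrite -natr1 in hx2 hy2.
  rewrite lee_fin -(ler_pM2l Nj0) divff ?gt_eqF//.
  rewrite -[X in X * _](ger0_norm (ltW Nj0)) -normrM mulrBr ler_norml.
  by rewrite -/N in hx1 hx2 hy1 hy2; lra.
pose c : R := ((N%:R : R) ^- j) `^ t.
have weightU i : (hausdorff_weight t (U i) <= (if i \in hit_columns r q A j then c else 0)%:E)%E.
  rewrite mem_hit_columns// /hausdorff_weight; case: asboolP => [_|nU].
    case: ifPn => [_|/set0P[x Ux]]; first by rewrite lee_fin powR_ge0.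
    rewrite /c -poweR_EFin; apply: gt0_ler_poweR => //; first exact: ltW.
      rewrite in_itv/= leey andbT; apply: ereal_sup_ubound; exists (x, x) => //=.
      by rewrite subrr normr0.
    by rewrite in_itv/= leey andbT lee_fin invr_ge0 ltW.
  rewrite ifT//; apply/eqP; rewrite -subset0 => x [Ax /= ex].
  by apply: nU; exists x.
apply: (@le_trans _ _ (\sum_(0 <= i <oo) hausdorff_weight t (U i))%E).
  apply: ereal_inf_lbound; exists U => //; split.
    by move=> x Ax; exists (column r q j x).
  by move=> i; apply: le_trans (diamU i) _; rewrite lee_fin ltW.
rewrite (nneseries_split 0 (N ^ j).+1)//.
rewrite [X in (_ + X)%E]eseries0 ?adde0; last first.
  move=> i Ni _; apply/eqP; rewrite eq_le w0 andbT.
  apply: le_trans (weightU i) _; case: ifPn => //.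
  by rewrite mem_filter mem_iota => /and3P[_ _]; rewrite ltnNge Ni.
apply: (@le_trans _ _ (\sum_(0 <= i < (N ^ j).+1)
    (if i \in hit_columns r q A j then c else 0)%:E)%E).
  by apply: lee_sum => i _; exact: weightU.
rewrite sumEFin lee_fin -big_mkcond /=.
have -> : \sum_(0 <= i < (N ^ j).+1 | i \in hit_columns r q A j) c =
    \sum_(i <- hit_columns r q A j) c.
  rewrite /index_iota subn0 [RHS]big_filter big_seq_cond [RHS]big_seq_cond.
  by apply: eq_bigl => i; rewrite mem_filter; case: (i \in _); rewrite ?andbT ?andbF.
rewrite big_const_seq count_predT iter_addr_0 -mulr_natl.
apply: le_trans (ltW cost); rewrite -rN mulrA.
by rewrite ler_wpM2r ?powR_ge0.
Qed.

(** * The value of V *)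

Lemma exists_ratio_between (R : realType) (g d : R) : 1 / 2 <= g -> g < d -> d <= 1 ->
  exists a b : nat, [/\ (0 < b)%N, (b < a)%N & g < a%:R / (a + b)%:R < d].
Proof.
move=> g2 gd d1.
pose n := (Num.truncn (d - g)^-1).+1.
have n0 : 0 < n%:R :> R by rewrite ltr0n.
have nd : 1 < n%:R * (d - g).
  by rewrite -ltr_pdivrMr ?subr_gt0// div1r truncnS_gt.
pose a := (Num.truncn (g * n%:R)).+1.
have gn0 : 0 <= g * n%:R by rewrite mulr_ge0//; lra.
have /andP[a1 a2] := truncn_itv gn0; rewrite -/a in a2.
have a3 : a%:R <= g * n%:R + 1 by rewrite /a -natr1 lerD2r.
have an : (a < n)%N.
  rewrite -(ltr_nat R); apply: (@lt_le_trans _ _ (d * n%:R)); first lra.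
  by rewrite ler_piMl.
have hn : 1 / 2 * n%:R <= g * n%:R by rewrite ler_pM2r.
exists a, (n - a)%N; split; first by rewrite subn_gt0.
  have : (n < 2 * a)%N by rewrite -(ltr_nat R) natrM; lra.
  lia.
by rewrite subnKC 1?ltnW// ltr_pdivlMr// ltr_pdivrMr// a2/=; lra.
Qed.

(** The function [zigzag_limit (3 ^ a) (3 ^ b)] is a competitor in the infimum. *)
Lemma V_le_ratio (R : realType) (alpha : R) (a b : nat) :
  0 < alpha -> (0 < b)%N -> (b < a)%N -> alpha <= a%:R / (a + b)%:R ->
  (V alpha <= (a%:R / (a + b)%:R)%:E)%E.
Proof.
move=> a0 b0 ba ab; set beta := a%:R / (a + b)%:R in ab *.
have q0 : (0 < 3 ^ b)%N by rewrite expn_gt0.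
have oq : odd (3 ^ b) by rewrite oddX orbT.
have r1 : (1 < 3 ^ a)%N by rewrite -(expn0 3) ltn_exp2l// (leq_trans _ ba).
have qr : (3 * 3 ^ b <= 3 ^ a)%N by rewrite -expnS leq_exp2l.
have Nb : ((3 ^ a * 3 ^ b)%:R : R) `^ beta = (3 ^ a)%:R.
  rewrite -expnD !natrX -!powR_mulrn// -powRrM; congr (_ `^ _).
  by rewrite /beta mulrC divfK// pnatr_eq0 -lt0n addn_gt0 b0 orbT.
apply: ge_ereal_inf; exists (ereal_sup [set hausdorff_dim A | A in
    [set A : set R | [/\ A !=set0, A `<=` `[0, 1] &
       bounded_variation_on A (zigzag_limit (3 ^ a) (3 ^ b))]]]).
  exists (zigzag_limit (3 ^ a) (3 ^ b)) => //.
  apply: (zigzag_limit_hoelder (ltnW r1) q0 oq r1 _ Nb).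
  by rewrite a0.
apply: ge_ereal_sup => _ [A [A0 A01 bA] <-].
exact: hausdorff_dim_zigzag_le q0 oq qr (lt_le_trans a0 ab) Nb A01 bA.
Qed.

Theorem theorem1p1 (R : realType) (alpha : R)
    (halpha0 : 0 < alpha) (halpha1 : alpha < 1) :
  V alpha = (Num.max (1 / 2) alpha)%:E.
Proof.
set g := Num.max (1 / 2) alpha.
have g1 : g < 1 by rewrite gt_max halpha1 andbT; lra.
have g2 : 1 / 2 <= g by rewrite le_max lexx.
have ga : alpha <= g by rewrite le_max lexx orbT.
apply/eqP; rewrite eq_le; apply/andP; split.
  apply/lee_addgt0Pr => e e0; rewrite -EFinD.
  have [||a [b [b0 ba /andP[gb be]]]] := @exists_ratio_between R g (Num.min (g + e) 1) g2.
  - by rewrite lt_min ltrDl e0 g1.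
  - by rewrite ge_min lexx orbT.
  apply: le_trans (V_le_ratio halpha0 b0 ba (le_trans ga (ltW gb))) _.
  by rewrite lee_fin ltW//; apply: lt_le_trans be _; rewrite ge_min lexx.
apply: le_ereal_inf_tmp => _ [f Hf <-].
set s := ereal_sup _.
rewrite /g /Num.max; case: ifP => _.
  have [|A [A0 A01 bA dA]] := exists_dim_ge_hoelder_exponent _ Hf; first by rewrite halpha0.
  by apply: le_trans dA _; apply: ereal_sup_ubound; exists A.
apply/lee_addgt0Pr => e e0.
pose j := (Num.truncn e^-1).+1.
have je : 1 < j%:R * e by rewrite -ltr_pdivrMr// div1r truncnS_gt.
have [A [A0 A01 bA dA]] := @exists_dim_ge_ratio R j alpha f halpha0 isT Hf.
have js : ((j%:R / (2 * j + 2)%:R)%:E <= s)%E.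
  by apply: le_trans dA _; apply: ereal_sup_ubound; exists A.
apply: (@le_trans _ _ ((j%:R / (2 * j + 2)%:R)%:E + e%:E)%E); last exact: leeD2r.
rewrite -EFinD lee_fin natrD natrM.
have j0 : 0 < j%:R :> R by rewrite ltr0n.
rewrite -lerBlDr ler_pdivlMr; last by rewrite addr_gt0// mulr_gt0.
nra.
Qed.
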